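(* There exists a positive numerical constant $c$ such that, for any $n\ge 2$, $p\ge 1$, any integer length $1\le r\le n/4$ and any $\zeta\in(0,1/\sqrt2)$, the following holds. Provided that $$r\zeta^2\le \big[c\,(p+\log(n/r))\big]\wedge\frac r2,$$ we have $$\inf_{\hat\tau}\ \sup_{\eta\in\bar{\mathcal P}(r,\zeta)}\mathbb P_\eta(\hat K\ne K)\ge\frac14,$$ where the infimum is over all estimators $\hat\tau$ of the change-point vector and $\hat K=|\hat\tau|$.
   Context: For a sequence $\eta=(\Sigma_1,\dots,\Sigma_n)$ of $p\times p$ covariance matrices, $\mathbb P_\eta$ is the distribution of $(y_1,\dots,y_n)$ with independent $y_t\sim\mathcal N(0,\Sigma_t)$. The change-points of $\eta$ are the integers $1=\tau_0<\tau_1<\dots<\tau_K<\tau_{K+1}=n+1$ such that $\Sigma_t$ is constant on each $[\tau_k,\tau_{k+1}-1]$ and $\Sigma_{\tau_k}\neq\Sigma_{\tau_k-1}$; $K=K(\eta)\ge0$; $r_k=\min(\tau_{k+1}-\tau_k,\tau_k-\tau_{k-1})$. $\|\cdot\|_{op}$ is the operator norm. $\bar{\mathcal P}(r,\zeta)$ is the collection of sequences $\eta=(\Sigma_1,\dots,\Sigma_n)$ such that for each $t$ either $\Sigma_t=I_p$ or $\|\Sigma_t\|_{op}=1+\zeta$, and whose change-points satisfy $\min_kr_k\ge r$ and $\min_k\|\Sigma_{\tau_k}-\Sigma_{\tau_{k-1}}\|_{op}\ge\zeta$ (constant sequences, $K=0$, satisfying the first requirement are included). An estimator $\hat\tau=(\hat\tau_1,\dots,\hat\tau_{\hat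 K})$ is any measurable function of $(y_1,\dots,y_n)$ with values in finite increasing vectors. *)

(* Defs.v *)
From HB Require Import structures.
From mathcomp Require Import all_boot all_order all_algebra.
From mathcomp Require Import all_classical all_reals all_analysis.

Set Implicit Arguments.
Unset Strict Implicit.
Unset Printing Implicit Defensive.

Import Order.TTheory GRing.Theory Num.Theory.

Local Open Scope classical_set_scope.
Local Open Scope ring_scope.

Definition l2norm (R : realType) (p : nat) (x : 'cV[R]_p) : R :=
  Num.sqrt (\sum_(i < p) x i 0 ^+ 2).

Definition opnorm (R : realType) (p : nat) (A : 'M[R]_p) : R :=
  sup [set l2norm (A *m x) | x in [set x : 'cV[R]_p | l2norm x <= 1]].

Definition covariance_matrix (R : realType) (p : nat) (S : 'M[R]_p) : Prop :=
  S^T = S /\ forall u : 'cV[R]_p, 0 <= (u^T *m S *m u) 0 0.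

(* The centred normal law on the line with variance [v >= 0]. The case v = 0 is
   separate because [normal_prob m 0] is not the Dirac mass at m. *)
Definition centred_normal (R : realType) (v : R) (B : set R) : \bar R :=
  if v == 0 then \d_(0 : R) B else normal_prob 0 (Num.sqrt v) B.

(* The law [mu] on R^p is N(0, S), for a possibly singular S: every linear form
   u^T x has law N(0, u^T S u) under [mu]. *)
Definition is_gaussian (R : realType) (p : nat) (S : 'M[R]_p)
    (mu : set (p.-tuple R) -> \bar R) : Prop :=
  forall (u : 'cV[R]_p) (B : set R), measurable B ->
    pushforward mu (fun x : p.-tuple R => \sum_(i < p) u i 0 * tnth x i) B
    = centred_normal ((u^T *m S *m u) 0 0) B.

(* [P] is the joint law of independent y_t ~ N(0, S_t), t = 1..n. Since each
   A_t may be the whole space, the product rule over all n coordinates covers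
   every subfamily. The two conditions determine [P] uniquely. *)
Definition is_law (R : realType) (n p : nat) (eta : n.-tuple 'M[R]_p)
    (P : probability (n.-tuple (p.-tuple R)) R) : Prop :=
  (forall t : 'I_n, is_gaussian (tnth eta t)
     (pushforward P (fun y : n.-tuple (p.-tuple R) => tnth y t))) /\
  (forall A : 'I_n -> set (p.-tuple R), (forall t, measurable (A t)) ->
     P [set y | forall t, A t (tnth y t)]
     = (\prod_(t < n) P [set y | A t (tnth y t)])%E).

(* Times are 1-based as in (S_1, ..., S_n): for 1 <= t <= n,
   [cov_at eta t] is S_t. *)
Definition cov_at (R : realType) (n p : nat) (eta : n.-tuple 'M[R]_p)
    (t : nat) : 'M[R]_p := nth 0 eta t.-1.

(* The interior change-points tau_1 < ... < tau_K. *)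
Definition change_points (R : realType) (n p : nat) (eta : n.-tuple 'M[R]_p)
    : seq nat :=
  [seq t <- index_iota 2 n.+1 | cov_at eta t != cov_at eta t.-1].

Definition nb_changes (R : realType) (n p : nat) (eta : n.-tuple 'M[R]_p)
    : nat := size (change_points eta).

(* tau_k for 0 <= k <= K + 1: tau_0 = 1, and the default value of [nth] gives
   tau_(K+1) = n + 1. *)
Definition change_point (R : realType) (n p : nat) (eta : n.-tuple 'M[R]_p)
    (k : nat) : nat := nth n.+1 (1%N :: change_points eta) k.

Definition segment_length (R : realType) (n p : nat) (eta : n.-tuple 'M[R]_p)
    (k : nat) : nat :=
  minn (change_point eta k.+1 - change_point eta k)
       (change_point eta k - change_point eta k.-1).

Definition Pbar (R : realType) (n p r : nat) (zeta : R)
    : set (n.-tuple 'M[R]_p) :=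
  [set eta | [/\ forall t, covariance_matrix (tnth eta t),
    forall t, tnth eta t = 1%:M \/ opnorm (tnth eta t) = 1 + zeta,
    forall k, (1 <= k <= nb_changes eta)%N -> (r <= segment_length eta k)%N &
    forall k, (1 <= k <= nb_changes eta)%N ->
      zeta <= opnorm (cov_at eta (change_point eta k) -
                      cov_at eta (change_point eta k.-1))]].

(* Measurability is with respect to the discrete sigma-algebra on the
   countable type [seq nat], so it suffices to consider singletons. *)
Definition estimator (R : realType) (n p : nat)
    : set (n.-tuple (p.-tuple R) -> seq nat) :=
  [set tauhat | (forall y, sorted ltn (tauhat y)) /\
                (forall s : seq nat, measurable (tauhat @^-1` [set s]))].

(* As [eta] determines the law [P], this is a supremum over eta in Pbar only. *)
Definition max_error (R : realType) (n p r : nat) (zeta : R)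
    (tauhat : n.-tuple (p.-tuple R) -> seq nat) : \bar R :=
  ereal_sup [set e | exists (eta : n.-tuple 'M[R]_p)
      (P : probability (n.-tuple (p.-tuple R)) R),
    [/\ Pbar r zeta eta, is_law eta P &
        e = P [set y | size (tauhat y) <> nb_changes eta]]].

(* Main.v *)
Require Import Defs.
From HB Require Import structures.
From mathcomp Require Import all_boot all_order all_algebra.
From mathcomp Require Import all_classical all_reals all_analysis.
From mathcomp Require Import measurable_realfun.
From mathcomp Require Import ring lra zify.
Set Implicit Arguments.
Unset Strict Implicit.
Unset Printing Implicit Defensive.
Import Order.TTheory GRing.Theory Num.Theory.
Local Open Scope classical_set_scope.
Local Open Scope ring_scope.

(** The proof is Le Cam's mixture argument.  The null hypothesis is the constant
    sequence of identity matrices, which has no change-point.  It is tested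
    against a uniform mixture over planted sequences, in which the covariance
    is I + zeta u u^T on one of m = n %/ r - 2 disjoint blocks of length r and I
    elsewhere, with u in {-1/sqrt p, 1/sqrt p}^p.  Each planted sequence has two
    change-points, because only interior blocks are used.  An estimator that
    gets the number of change-points right with probability more than 3/4 under
    all these laws would separate the null from the mixture.

    If g is the density of the mixture with respect to the null law, the sum of
    the two error probabilities of any test is at least the integral of
    min(1, g), and min(1, g) >= g - g^2/4 since (1 - g/2)^2 >= 0.  As g has
    integral 1, a second moment of g at most 2 leaves 1 - 2/4 = 1/2, so one of
    the two errors is at least 1/4 (le_cam).

    The second moment is an average of overlaps of likelihood ratios.  Two
    different blocks have overlap 1, by independence.  Two directions u, v on
    the same block have overlap (1 - zeta^2 <u,v>^2)^(-r/2), because the two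
    densities of one observation have overlap (1 - zeta^2 <u,v>^2)^(-1/2)
    (spike_overlap).  It remains to see that the average over u of this overlap
    is at most m + 1 (overlap_bound).  It is at most the average of
    exp(r zeta^2 <u,v>^2), and r zeta^2 <= (p + log(n/r)) / 16 splits the
    exponent in two: the part in p costs a factor sqrt 2, since
    sqrt p * <u,v> is subgaussian, and the part in log(n/r) costs at most
    (n/r)^(1/16), which m + 1 absorbs.

    The spiked normal law is realised as the law of x + g w, with x a standard
    Gaussian vector, g an independent standard normal variable and
    w = sqrt zeta u.  Then its linear forms are Gaussian as sums of independent
    normal variables (gauss_convolution), and its density comes from averaging
    over g the density of a translated Gaussian vector
    (integral_spiked_gaussian). *)

(** * Finite products of probability measures on tuples *)

Section TupleProduct.
Context d (T : measurableType d) (R : realType).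
Local Open Scope ereal_scope.

(** Packaged as a measurable map, so that the product on tuples of size [n.+1]
    can be defined as a pushforward of a binary product. *)
Definition cons_pair n (z : T * n.-tuple T) : n.+1.-tuple T :=
  [tuple of z.1 :: z.2].

Lemma measurable_cons_pair n : measurable_fun [set: T * n.-tuple T] (@cons_pair n).
Proof. by apply: measurable_cons. Qed.

HB.instance Definition _ n :=
  isMeasurableFun.Build _ _ _ _ (@cons_pair n) (@measurable_cons_pair n).

Fixpoint tuple_prod n : ('I_n -> probability T R) -> probability (n.-tuple T) R :=
  if n is n'.+1 then fun nu =>
    distribution (nu ord0 \x tuple_prod (nu \o lift ord0)) (@cons_pair n')
  else fun=> \d_[tuple].

Lemma integral_tuple_prodS n (nu : 'I_n.+1 -> probability T R)
    (h : n.+1.-tuple T -> \bar R) :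
  measurable_fun [set: n.+1.-tuple T] h -> (forall y, 0 <= h y) ->
  \int[tuple_prod nu]_y h y =
  \int[nu ord0]_a \int[tuple_prod (nu \o lift ord0)]_y h [tuple of a :: y].
Proof.
move=> mh h0 /=; rewrite ge0_integral_distribution//.
rewrite fubini_tonelli1//=.
by apply: measurableT_comp => //; exact: measurable_cons_pair.
Qed.

Lemma measurable_prod_tnth n (l : 'I_n -> T -> R) :
  (forall i, measurable_fun setT (l i)) ->
  measurable_fun [set: n.-tuple T] (fun y : n.-tuple T => \prod_(i < n) l i (tnth y i))%R.
Proof.
move=> ml; apply: measurable_prod => i _.
apply: measurableT_comp => //; exact: measurable_tnth.
Qed.

Lemma integral_tuple_prod_prod n (nu : 'I_n -> probability T R)
    (l : 'I_n -> T -> R) :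
  (forall i, measurable_fun setT (l i)) -> (forall i x, (0 <= l i x)%R) ->
  \int[tuple_prod nu]_y (\prod_(i < n) l i (tnth y i))%:E =
  \prod_(i < n) \int[nu i]_x (l i x)%:E.
Proof.
elim: n nu l => [|n IH] nu l ml l0.
  rewrite big_ord0 (eq_integral (cst 1)); last by move=> y _; rewrite big_ord0.
  by rewrite integral_cst// mul1e; exact: probability_setT.
rewrite integral_tuple_prodS; last 2 first.
- by apply/measurable_EFinP; exact: measurable_prod_tnth.
- by move=> y; rewrite lee_fin prodr_ge0.
have prod0 : 0 <= \prod_(i < n) \int[nu (lift ord0 i)]_x (l (lift ord0 i) x)%:E.
  by apply: prode_ge0 => i _; apply: integral_ge0 => x _; rewrite lee_fin.
rewrite big_ord_recl -ge0_integralZr//; last 2 first.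
- exact/measurable_EFinP.
- by move=> x _; rewrite lee_fin.
apply: eq_integral => a _; rewrite -(IH (nu \o lift ord0)) => [||i x]//.
rewrite -ge0_integralZl//=.
- by apply: eq_integral => y _; rewrite -EFinM big_ord_recl; congr EFin; congr (_ * _)%R;
    apply: eq_bigr => i _; rewrite tnthS.
- apply/measurable_EFinP.
  exact: (@measurable_prod_tnth _ (fun i => l (lift ord0 i))).
- by move=> y _; rewrite lee_fin prodr_ge0.
- by rewrite lee_fin.
Qed.

(** One lemma serves at two levels: with [f i] a translation it computes the
    density of a translated Gaussian vector from its coordinates, and with
    [f i] the identity it multiplies the densities of independent
    observations.  The hypothesis on [nu] and [nu'] is in integral form, so
    that no measure with a density has to be built.  By induction on [n], with
    the first coordinate integrated last. *)
Lemma tuple_prod_change n (nu nu' : 'I_n -> probability T R)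
    (f : 'I_n -> T -> T) (l : 'I_n -> T -> R) :
  (forall i, measurable_fun setT (f i)) ->
  (forall i, measurable_fun setT (l i)) -> (forall i x, (0 <= l i x)%R) ->
  (forall i (h : T -> \bar R), measurable_fun setT h -> (forall x, 0 <= h x) ->
    \int[nu i]_x h (f i x) = \int[nu' i]_x (h x * (l i x)%:E)) ->
  forall h : n.-tuple T -> \bar R,
    measurable_fun [set: n.-tuple T] h -> (forall y, 0 <= h y) ->
  \int[tuple_prod nu]_y h [tuple f i (tnth y i) | i < n] =
  \int[tuple_prod nu']_y (h y * (\prod_(i < n) l i (tnth y i))%:E).
Proof.
elim: n nu nu' f l => [|n IH] nu nu' f l mf ml l0 nul h mh h0.
  rewrite (eq_integral h)/=; last first.
    by move=> y _; rewrite (tuple0 y); congr h; apply/val_inj; rewrite tuple0.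
  by apply: eq_integral => y _; rewrite big_ord0 mule1.
have mmap m (F : 'I_m -> T -> T) : (forall i, measurable_fun setT (F i)) ->
    measurable_fun [set: m.-tuple T]
      (fun y : m.-tuple T => [tuple F i (tnth y i) | i < m]).
  move=> mF; apply/measurable_fun_tnthP => i.
  rewrite (_ : _ \o _ = F i \o (@tnth m T ^~ i)); last first.
    by apply/funext => y; rewrite /comp tnth_mktuple.
  by apply: measurableT_comp => //; exact: measurable_tnth.
have mcons a : measurable_fun [set: n.-tuple T] (fun y : n.-tuple T => [tuple of a :: y]).
  by apply: measurable_cons.
rewrite integral_tuple_prodS//; last first.
  by apply: measurableT_comp => //; exact: mmap.
rewrite integral_tuple_prodS//; last 2 first.
- apply: emeasurable_funM => //.
  by apply/measurable_EFinP; exact: measurable_prod_tnth.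
- by move=> y; rewrite mule_ge0// lee_fin prodr_ge0.
pose g a := \int[tuple_prod (nu' \o lift ord0)]_y
  (h [tuple of a :: y] * (\prod_(i < n) l (lift ord0 i) (tnth y i))%:E).
have mg : measurable_fun setT g.
  apply: (@measurable_fun_fubini_tonelli_F _ _ _ _ _ _
    (fun z => h (cons_pair z) * (\prod_(i < n) l (lift ord0 i) (tnth z.2 i))%:E)) => //=.
  apply: emeasurable_funM.
    by apply: measurableT_comp => //; exact: measurable_cons_pair.
    apply/measurable_EFinP.
    apply: (@measurableT_comp _ _ _ _ _ _ (fun y : n.-tuple T =>
      \prod_(i < n) l (lift ord0 i) (tnth y i))%R) => //.
    exact: (@measurable_prod_tnth _ (fun i => l (lift ord0 i))).
  by move=> y; rewrite mule_ge0// lee_fin prodr_ge0.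
transitivity (\int[nu ord0]_a g (f ord0 a)).
  apply: eq_integral => a _.
  rewrite /g -(IH (nu \o lift ord0) (nu' \o lift ord0) (f \o lift ord0)
    (l \o lift ord0) _ _ _ _ (fun y => h [tuple of f ord0 a :: y]))//=.
  - apply: eq_integral => y _; congr h; apply: eq_from_tnth => i.
    rewrite tnth_mktuple.
    have [j ->|->] := unliftP ord0 i; last by rewrite !tnth0.
    by rewrite !tnthS tnth_mktuple.
  - by move=> i h1; exact: nul.
  - exact: measurableT_comp.
rewrite nul//; last first.
  by move=> a; apply: integral_ge0 => y _; rewrite mule_ge0// lee_fin prodr_ge0.
apply: eq_integral => a _; rewrite /g -ge0_integralZr//; last 3 first.
- apply: emeasurable_funM; first exact: measurableT_comp.
  apply/measurable_EFinP.
  exact: (@measurable_prod_tnth _ (fun i => l (lift ord0 i))).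
- by move=> y _; rewrite mule_ge0// lee_fin prodr_ge0.
- by rewrite lee_fin.
apply: eq_integral => y _; rewrite -muleA; congr (_ * _).
rewrite -EFinM big_ord_recl mulrC; congr EFin; congr (_ * _)%R => /=.
by apply: eq_bigr => i _; rewrite tnthS.
Qed.

Lemma tuple_prod_box n (nu : 'I_n -> probability T R) (A : 'I_n -> set T) :
  (forall i, measurable (A i)) ->
  tuple_prod nu [set y | forall i, A i (tnth y i)] = \prod_(i < n) nu i (A i).
Proof.
move=> mA.
have mB : measurable [set y : n.-tuple T | forall i, A i (tnth y i)].
  rewrite (_ : mkset _ = \big[setI/setT]_(i < n) ((@tnth _ T)^~ i @^-1` A i)).
    apply: bigsetI_measurable => i _; rewrite -[X in measurable X]setTI.
    exact: measurable_tnth.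
  apply/seteqP; split => y; rewrite -bigcap_seq/=.
    by move=> Ay i _; exact: Ay.
  by move=> Ay i; apply: Ay; rewrite /= mem_index_enum.
transitivity (\int[tuple_prod nu]_y
    (\1_[set y : n.-tuple T | forall i, A i (tnth y i)] y)%:E).
  by rewrite integral_indic// setIT.
rewrite (eq_bigr (fun i => \int[nu i]_x (\1_(A i) x)%:E)); last first.
  by move=> i _; rewrite integral_indic// setIT.
rewrite -(integral_tuple_prod_prod nu (fun i => measurable_indic (mA i)))//.
apply: eq_integral => y _; congr EFin; rewrite indicE.
have [/set_mem yB|yB] := boolP (y \in _).
  by rewrite big1// => i _; rewrite indicE mem_set.
apply/esym/eqP/prodf_eq0.
move: yB; rewrite notin_setE/= => /existsNP[i Ai].
by exists i => //; rewrite indicE memNset.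
Qed.

Lemma tuple_prod_proj n (nu : 'I_n -> probability T R) (t : 'I_n) (A : set T) :
  measurable A -> tuple_prod nu [set y | A (tnth y t)] = nu t A.
Proof.
move=> mA.
have -> : [set y : n.-tuple T | A (tnth y t)] =
    [set y | forall i, (if i == t then A else setT) (tnth y i)].
  apply/seteqP; split => y /=; last by move/(_ t); rewrite eqxx.
  by move=> Ay i; case: eqP => [->|].
rewrite (@tuple_prod_box _ nu (fun i => if i == t then A else setT)); last first.
  by move=> i; case: ifP.
rewrite (bigD1 t)//= eqxx big1 ?mule1// => i /negPf ->.
exact: probability_setT.
Qed.

End TupleProduct.

(** * Densities and affine changes of variable *)

Section Density.
Local Open Scope ereal_scope.
Context d (T : measurableType d) (R : realType).
Variables (mu nu : {measure set T -> \bar R}) (f : T -> R).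
Hypotheses (mf : measurable_fun setT f) (f0 : forall x, (0 <= f x)%R).
Hypothesis nuE : forall A, measurable A -> nu A = \int[mu]_(x in A) (f x)%:E.

Import HBNNSimple.

(** By linearity from indicators to simple functions, then by monotone
    convergence. *)
Lemma integral_density (h : T -> \bar R) :
  measurable_fun setT h -> (forall x, 0 <= h x) ->
  \int[nu]_x h x = \int[mu]_x (h x * (f x)%:E).
Proof.
move=> mh h0; pose h_ := nnsfun_approx measurableT mh.
have hE x : h x = limn (fun n => (h_ n x)%:E).
  by apply/esym/cvg_lim => //; exact: cvg_nnsfun_approx.
transitivity (limn (fun n => \int[nu]_x (h_ n x)%:E)).
  rewrite -monotone_convergence//.
  - by apply: eq_integral => x _; exact: hE.
  - by move=> n; exact/measurable_EFinP.
  - by move=> n x _; rewrite lee_fin.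
  - by move=> x _ a b ab; rewrite lee_fin; exact/lefP/nd_nnsfun_approx.
transitivity (limn (fun n => \int[mu]_x ((h_ n x)%:E * (f x)%:E))); last first.
  rewrite -monotone_convergence//.
  - apply: eq_integral => x _; apply/cvg_lim => //.
    by apply: cvgeZr => //; exact: cvg_nnsfun_approx.
  - by move=> n; apply: emeasurable_funM; exact/measurable_EFinP.
  - by move=> n x _; rewrite mule_ge0// lee_fin.
  - move=> x _ a b ab; rewrite lee_wpmul2r ?lee_fin//.
    exact/lefP/nd_nnsfun_approx.
congr (limn _); apply/funext => n.
have mind r : measurable_fun setT (fun x => (r * \1_(h_ n @^-1` [set r]) x)%:E).
  by apply/measurable_EFinP; exact: measurable_funM.
transitivity (\sum_(r \in range (h_ n))
    \int[nu]_x (r * \1_(h_ n @^-1` [set r]) x)%:E).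
  rewrite -ge0_integral_fsum//; last first.
    by move=> r x _; exact: nnfun_muleindic_ge0.
  by apply: eq_integral => x _; rewrite /= fimfunE -fsumEFin.
transitivity (\sum_(r \in range (h_ n))
    \int[mu]_x ((r * \1_(h_ n @^-1` [set r]) x)%:E * (f x)%:E)); last first.
  rewrite -ge0_integral_fsum//; last 2 first.
  - by move=> r; apply: emeasurable_funM => //; exact/measurable_EFinP.
  - by move=> r x _; rewrite mule_ge0 ?lee_fin//; exact: nnfun_muleindic_ge0.
  apply: eq_integral => x _; rewrite /= fimfunE -fsumEFin//.
  by rewrite ge0_mule_fsuml// => r; exact: nnfun_muleindic_ge0.
apply: eq_fsbigr => r _; rewrite integralZl_indic_nnsfun//.
under [RHS]eq_integral do rewrite EFinM -muleA.
have [r0|r0] := ltP r 0%R.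
  rewrite preimage_nnfun0// indic0.
  by rewrite !integral0_eq ?mule0// => x _; rewrite /= ?mul0e ?mule0.
rewrite ge0_integralZl//.
- rewrite integral_indic// setIT nuE//; congr (_ * _).
  by rewrite [LHS]integral_mkcond epatch_indic; apply: eq_integral => x _; rewrite muleC.
- by apply: emeasurable_funM; exact/measurable_EFinP.
- by move=> x _; rewrite mule_ge0 ?lee_fin.
Qed.

End Density.

Section Affine.
Context (R : realType).
Local Notation mu := (@lebesgue_measure R).

Definition affine (a b : R) (x : measurableTypeR R) : measurableTypeR R := (a + b * x)%R.

Lemma measurable_affine a b : measurable_fun setT (affine a b).
Proof. by apply: measurable_funD => //; exact: measurable_funM. Qed.

HB.instance Definition _ a b :=
  isMeasurableFun.Build _ _ _ _ (affine a b) (measurable_affine a b).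

Let lebesgue_affine_gt0 (a b : R) (A : set R) : (0 < b)%R -> measurable A ->
  (mu A = b%:E * pushforward mu (affine a b) A)%E.
Proof.
move=> b0 mA.
pose b' := NngNum (ltW b0).
rewrite (@lebesgue_measure_unique R (mscale b' (pushforward mu (affine a b))) _ A mA)//.
move=> _ [[x y]] _ <- /=; rewrite /mscale/= /pushforward.
have -> : affine a b @^-1` `]x, y] = `](x - a) / b, (y - a) / b]%classic.
  apply/seteqP; split => z; rewrite /affine/= !in_itv/= ltr_pdivrMr// ler_pdivlMr//;
  by rewrite ltrBlDl lerBrDl (mulrC z).
rewrite !lebesgue_measure_itv/= !lte_fin.
rewrite ltr_pM2r ?invr_gt0// ltrD2r.
case: ifPn => _; last by rewrite mule0.
by rewrite -!EFinD -EFinM; congr EFin; field; rewrite gt_eqF.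
Qed.

(** The case of a negative slope reduces to the other by the reflection
    invariance of the Lebesgue measure. *)
Lemma lebesgue_affine (a b : R) (A : set R) : (b != 0)%R -> measurable A ->
  (mu A = `|b|%:E * pushforward mu (affine a b) A)%E.
Proof.
move=> b0 mA; have [b1|b1|/eqP] := ltgtP b 0%R; last by rewrite (negPf b0).
- rewrite ltr0_norm// -lebesgue_measureN//.
  rewrite {1}/pushforward (@lebesgue_affine_gt0 (- a) (- b))%R//.
  + rewrite /pushforward; congr (_ * mu _)%E; apply/seteqP.
    by split => x; rewrite /= /affine/= opprD opprK mulNr opprK.
  + by rewrite oppr_gt0.
  + by rewrite -[X in measurable X]setTI; exact: oppr_measurable.
- by rewrite gtr0_norm//; exact: lebesgue_affine_gt0.
Qed.

Lemma integral_affine (a b : R) (h : R -> \bar R) : (b != 0)%R ->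
  measurable_fun setT h -> (forall x, 0 <= h x)%E ->
  (\int[mu]_x h x = `|b|%:E * \int[mu]_x h (a + b * x)%R)%E.
Proof.
move=> b0 mh h0.
have b1 : (0 <= `|b|)%R by [].
rewrite (eq_measure_integral (mscale (NngNum b1) (pushforward mu (affine a b)))).
  by rewrite ge0_integral_mscale//= ge0_integral_pushforward.
by move=> A mA _; exact: lebesgue_affine.
Qed.

End Affine.

(** * The standard normal law on the line *)

Section StdNormal.
Context (R : realType).

Let idR : measurableTypeR R -> R := idfun.

Let measurable_idR : measurable_fun setT idR.
Proof. by move=> _ B mB; rewrite setTI. Qed.

HB.instance Definition _ := isMeasurableFun.Build _ _ _ _ idR measurable_idR.

(** [normal_prob] lives on [measurableTypeR R], whose measurable sets are those
    of [R] but whose display differs; the identity transports it to [R], over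
    which tuples are formed. *)
Definition std_normal : probability R R := distribution (normal_prob 0 1) idR.

End StdNormal.

Section Gauss.
Context (R : realType).
Local Notation mu := (@lebesgue_measure R).
Local Notation gauss := (std_normal R).

Lemma integral_normal (m s : R) (h : R -> \bar R) :
  measurable_fun setT h -> (forall x, 0 <= h x)%E ->
  (\int[normal_prob m s]_x h x = \int[mu]_x (h x * (normal_pdf m s x)%:E))%E.
Proof.
move=> mh h0; apply: (@integral_density _ _ R mu) => //.
- exact: measurable_normal_pdf.
- exact: normal_pdf_ge0.
Qed.

Lemma integral_std_normal (h : R -> \bar R) :
  measurable_fun setT h -> (forall x, 0 <= h x)%E ->
  (\int[gauss]_x h x = \int[mu]_x (h x * (normal_pdf 0 1 x)%:E))%E.
Proof.
move=> mh h0; apply: etrans (integral_normal 0 1 mh h0).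
exact: ge0_integral_distribution.
Qed.

Lemma normal_pdf_affine (m b x : R) : b != 0 ->
  `|b| * normal_pdf m `|b| (m + b * x) = normal_pdf 0 1 x.
Proof.
move=> b0; have nb0 : `|b| != 0 by rewrite normr_eq0.
rewrite !normal_pdfE ?oner_eq0//.
rewrite /normal_peak /normal_fun mulrA; congr (_ * expR _).
  rewrite -mulrnAr sqrtrM ?sqr_ge0// sqrtr_sqr normr_id invfM mulrA divff// mul1r.
  by rewrite expr1n mul1r.
by rewrite real_normK ?num_real//; field.
Qed.

Lemma integral_gauss_affine (m b : R) (h : R -> \bar R) : b != 0 ->
  measurable_fun setT h -> (forall x, 0 <= h x)%E ->
  (\int[gauss]_x h (m + b * x)%R = \int[normal_prob m `|b|]_x h x)%E.
Proof.
move=> b0 mh h0.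
have maff : measurable_fun setT (fun x : R => m + b * x).
  exact: measurable_affine.
pose k (x : R) := (h x * (normal_pdf m `|b| x)%:E)%E.
have mk : measurable_fun setT k.
  by apply: emeasurable_funM => //; apply/measurable_EFinP;
    exact: measurable_normal_pdf.
have k0 x : (0 <= k x)%E by rewrite mule_ge0// lee_fin normal_pdf_ge0.
have mhaff : measurable_fun setT (fun x : R => h (m + b * x)).
  exact: measurableT_comp.
apply: etrans (esym (integral_normal m `|b| mh h0)).
apply: etrans (esym (integral_affine m b0 mk k0)).
apply: (etrans (integral_std_normal mhaff _)) => //.
have mkaff : measurable_fun setT (fun x : R => k (m + b * x)).
  exact: measurableT_comp.
rewrite -ge0_integralZl_EFin//.
by apply: eq_integral => x _; rewrite /k muleCA -EFinM normal_pdf_affine.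
Qed.

(** Completing the square.  With [b = 0] this is the Laplace transform, used to
    linearise a square in an exponent; with [s = 0] and [b < 0] it is the
    exponential moment of the square of a normal variable. *)
Lemma integral_gauss_expR (s b : R) : 0 < 1 + b ->
  (\int[gauss]_x (expR (s * x - b / 2 * x ^+ 2))%:E =
   ((Num.sqrt (1 + b))^-1 * expR (s ^+ 2 / (2 * (1 + b))))%:E)%E.
Proof.
move=> b0; have q0 : 0 < Num.sqrt (1 + b) by rewrite sqrtr_gt0.
have b1 : 1 + b != 0 by rewrite gt_eqF.
rewrite integral_std_normal//; last first.
  apply/measurable_EFinP/measurableT_comp => //.
  apply: measurable_funB; first exact: measurable_funM.
  by apply: measurable_funM => //; exact: measurable_funX.
set K := _ * expR _.
have K0 : 0 <= K by rewrite mulr_ge0 ?expR_ge0// invr_ge0.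
transitivity (\int[mu]_x (K%:E *
    (normal_pdf (s / (1 + b)) (Num.sqrt (1 + b))^-1 x)%:E))%E.
  apply: eq_integral => x _; rewrite -!EFinM; congr EFin.
  rewrite !normal_pdfE ?oner_eq0 ?invr_eq0 ?gt_eqF//.
  rewrite /normal_peak /normal_fun mulrCA -expRD.
  rewrite /K [RHS]mulrACA -expRD; congr (_ * expR _).
    rewrite exprVn sqr_sqrtr ?ltW// expr1n mul1r -mulrnAr sqrtrM ?invr_ge0 ?ltW//.
    by rewrite sqrtrV ?ltW// invfM invrK mulrA mulVf ?gt_eqF// mul1r.
  by rewrite exprVn sqr_sqrtr ?ltW//; field.
rewrite ge0_integralZl_EFin//.
- by rewrite integral_normal_pdf mule1.
- by move=> x _; rewrite lee_fin normal_pdf_ge0.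
- by apply/measurable_EFinP; exact: measurable_normal_pdf.
Qed.

(** The Cameron-Martin formula on the line. *)
Lemma integral_gauss_shift (m : R) (h : R -> \bar R) :
  measurable_fun setT h -> (forall x, 0 <= h x)%E ->
  (\int[gauss]_x h (x + m)%R =
   \int[gauss]_x (h x * (expR (m * x - m ^+ 2 / 2))%:E))%E.
Proof.
move=> mh h0.
transitivity (\int[gauss]_x h (m + 1 * x)%R)%E.
  by apply: eq_integral => x _; rewrite mul1r addrC.
have me : measurable_fun setT (fun x : R => (expR (m * x - m ^+ 2 / 2))%:E).
  apply/measurable_EFinP/measurableT_comp => //.
  by apply: measurable_funB => //; exact: measurable_funM.
apply: (etrans (integral_gauss_affine m (oner_neq0 _) mh h0)); rewrite normr1.
apply: (etrans (integral_normal m 1 mh h0)).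
apply: esym; apply: (etrans (integral_std_normal (emeasurable_funM mh me) _)).
  by move=> x; rewrite mule_ge0// lee_fin expR_ge0.
apply: eq_integral => x _; rewrite -muleA; congr (_ * _)%E; rewrite -EFinM.
rewrite !normal_pdfE ?oner_eq0// /normal_fun mulrCA -expRD.
by congr (_ * expR _)%:E; field.
Qed.

Lemma std_normal_scale (s : R) (A : set R) : 0 < s -> measurable A ->
  gauss [set x | A (s * x)] = normal_prob 0 s A.
Proof.
move=> s0 mA; have ms : measurable_fun setT (fun x : R => s * x).
  exact: measurable_funM.
transitivity (\int[gauss]_x (\1_A (0 + s * x)%R)%:E)%E.
  transitivity (\int[gauss]_x (\1_[set x | A (s * x)] x)%:E)%E.
    rewrite integral_indic ?setIT//.
    by rewrite -[X in measurable X]setTI; exact: ms.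
  apply: eq_integral => x _; rewrite add0r !indicE; congr ((_ : bool)%:R%:E).
rewrite (@integral_gauss_affine 0 s (fun x => (\1_A x)%:E)) ?gt_eqF//.
  by rewrite gtr0_norm// integral_indic// setIT.
by apply/measurable_EFinP; exact: measurable_indic.
Qed.

Lemma measurable_affine_preimage (c a : R) (B : set R) : measurable B ->
  measurable [set s : R | B (c * a + s)].
Proof.
move=> mB; rewrite -[X in measurable X]setTI.
have mf : measurable_fun setT (fun s : R => c * a + s) by exact: measurable_funD.
exact: mf.
Qed.

(** The law of a sum of two independent centred normal variables, in the form
    met when one coordinate of a Gaussian vector is integrated out.  If both
    variances are positive, Fubini leaves for each [z] a Gaussian integral over
    [a], which completing the square evaluates to the target density. *)
Lemma gauss_convolution (c v : R) (B : set R) : 0 <= v -> measurable B ->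
  (\int[gauss]_a centred_normal v [set s | B (c * a + s)%R] =
   centred_normal (c ^+ 2 + v) B)%E.
Proof.
move=> v0 mB; rewrite /centred_normal.
have [->|c0] := eqVneq c 0.
  under eq_integral => a _.
    rewrite mul0r (_ : [set s | _] = B); last by under eq_set do rewrite add0r.
    over.
  rewrite expr0n add0r integral_cst//.
  by rewrite [X in (_ * X)%E]probability_setT mule1.
have c2 : 0 < c ^+ 2 by rewrite exprn_even_gt0.
have [->|vn0] := eqVneq v 0.
  rewrite addr0 gt_eqF//.
  transitivity (\int[gauss]_a (\1_B (0 + c * a)%R)%:E)%E.
    apply: eq_integral => a _; rewrite diracE add0r; congr ((_ : bool)%:R%:E).
    by apply/idP/idP; rewrite !inE /= addr0.
  rewrite (@integral_gauss_affine 0 c (fun x => (\1_B x)%:E))//.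
  - by rewrite sqrtr_sqr integral_indic// setIT.
  - by apply/measurable_EFinP; exact: measurable_indic.
have {vn0} v0 : 0 < v by rewrite lt_neqAle eq_sym vn0.
have cv : 0 < c ^+ 2 + v by rewrite addr_gt0.
rewrite gt_eqF//.
have sv : Num.sqrt v != 0 by rewrite gt_eqF// sqrtr_gt0.
have scv : Num.sqrt (c ^+ 2 + v) != 0 by rewrite gt_eqF// sqrtr_gt0.
pose F (z : R * R) := ((\1_B z.2)%:E * (normal_pdf (c * z.1) (Num.sqrt v) z.2)%:E)%E.
have mF : measurable_fun setT F.
  apply: emeasurable_funM; first exact/measurable_EFinP/measurableT_comp.
  apply/measurable_EFinP.
  rewrite (_ : (fun _ => _) =
      (fun z : R * R => normal_pdf 0 (Num.sqrt v) (z.2 - c * z.1))).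
    apply: measurableT_comp; first exact: measurable_normal_pdf.
    by apply: measurable_funB => //; exact: measurable_funM.
  by apply/funext => z; rewrite !normal_pdfE// normal_fun_center.
have F0 z : (0 <= F z)%E by rewrite mule_ge0 ?lee_fin ?normal_pdf_ge0.
transitivity (\int[gauss]_a \int[mu]_z F (a, z))%E.
  apply: eq_integral => a _.
  rewrite /normal_prob integral_mkcond epatch_indic.
  rewrite [LHS](@integral_affine _ (- (c * a)) 1)//.
  - rewrite normr1 mul1e; apply: eq_integral => z _; rewrite muleC /F/=.
    congr (_ * _)%E.
      by rewrite !indicE; congr ((_ : bool)%:R%:E); apply/idP/idP;
         rewrite !inE/= mul1r addNKr.
    by rewrite !normal_pdfE// [in RHS]normal_fun_center/= mul1r addrC.
  - apply: emeasurable_funM.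
      by apply/measurable_EFinP; exact: measurable_normal_pdf.
    by apply/measurable_EFinP/measurable_indic; exact: measurable_affine_preimage.
  - by move=> z; rewrite mule_ge0 ?lee_fin ?normal_pdf_ge0.
rewrite (@fubini_tonelli _ _ _ _ _ gauss mu F mF F0).
rewrite /normal_prob [RHS]integral_mkcond epatch_indic.
apply: eq_integral => z _; rewrite /F/= ge0_integralZl//; last 2 first.
- apply/measurable_EFinP.
  rewrite (_ : (fun _ => _) = (fun a : R => normal_pdf 0 (Num.sqrt v) (z - c * a))).
    apply: measurableT_comp; first exact: measurable_normal_pdf.
    by apply: measurable_funB => //; exact: measurable_funM.
  by apply/funext => a; rewrite !normal_pdfE// normal_fun_center.
- by move=> a _; rewrite lee_fin normal_pdf_ge0.
rewrite muleC; congr (_ * _)%E.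
pose K := normal_peak (Num.sqrt v) * expR (- z ^+ 2 / (2 * v)).
transitivity (\int[gauss]_a (K%:E *
    (expR (c * z / v * a - (c ^+ 2 / v) / 2 * a ^+ 2))%:E))%E.
  apply: eq_integral => a _; rewrite -EFinM normal_pdfE//; congr EFin.
  rewrite /K /normal_fun -[RHS]mulrA -expRD; congr (_ * expR _).
  by rewrite sqr_sqrtr ?ltW//; field; rewrite gt_eqF.
have c2v : 0 < 1 + c ^+ 2 / v by rewrite addr_gt0// divr_gt0.
have K0 : 0 <= K by rewrite mulr_ge0 ?expR_ge0 ?normal_peak_ge0.
rewrite ge0_integralZl_EFin//; last first.
  apply/measurable_EFinP/measurableT_comp => //.
  apply: measurable_funB; first exact: measurable_funM.
  by apply: measurable_funM => //; exact: measurable_funX.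
rewrite integral_gauss_expR// -EFinM normal_pdfE//; congr EFin.
rewrite /K mulrACA -expRD /normal_peak -invfM; congr (_^-1 * expR _).
  rewrite !sqr_sqrtr ?ltW// -!mulrnAr -sqrtrM; last first.
    by apply: mulr_ge0; [exact: ltW | apply: mulrn_wge0; exact: pi_ge0].
  by congr Num.sqrt; field; rewrite gt_eqF.
rewrite sqr_sqrtr ?ltW// subr0; field.
by rewrite !gt_eqF// [v + _]addrC.
Qed.

End Gauss.

(** * Spiked Gaussian vectors *)

Section Spike.
Context (R : realType).
Local Notation gauss := (std_normal R).

Definition std_gaussian p : probability (p.-tuple R) R :=
  tuple_prod (fun _ : 'I_p => gauss).

Definition dot p (w : 'I_p -> R) (x : p.-tuple R) : R :=
  \sum_(i < p) w i * tnth x i.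

Lemma measurable_dot p (w : 'I_p -> R) :
  measurable_fun [set: p.-tuple R] (dot w).
Proof.
apply: measurable_sum => i; apply: measurable_funM => //.
exact: measurable_tnth.
Qed.

Lemma measurable_preimage d d' (T : measurableType d) (U : measurableType d')
  (f : T -> U) (B : set U) : measurable_fun setT f -> measurable B ->
  measurable (f @^-1` B).
Proof. by move=> mf mB; rewrite -[X in measurable X]setTI; exact: mf. Qed.

(** Coordinate by coordinate, each step being a convolution. *)
Lemma std_gaussian_dot p (w : 'I_p -> R) (B : set R) : measurable B ->
  std_gaussian p (dot w @^-1` B) = centred_normal (\sum_(i < p) w i ^+ 2) B.
Proof.
elim: p w B => [|p IH] w B mB.
  rewrite /centred_normal !big_ord0 eqxx /= !diracE; congr ((_ : bool)%:R%:E).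
  by apply/idP/idP; rewrite !inE /= /dot big_ord0.
transitivity (\int[std_gaussian p.+1]_y (\1_(dot w @^-1` B) y)%:E)%E.
  by rewrite integral_indic ?setIT//; apply: measurable_preimage => //;
     exact: measurable_dot.
have mi : measurable_fun [set: p.+1.-tuple R]
    (fun y => (\1_(dot w @^-1` B) y)%:E : \bar R).
  apply/measurable_EFinP/measurable_indic.
  by apply: measurable_preimage => //; exact: measurable_dot.
rewrite integral_tuple_prodS//.
rewrite big_ord_recl -gauss_convolution//; last first.
  by apply: sumr_ge0 => i _; exact: sqr_ge0.
apply: eq_integral => a _.
rewrite -IH; last exact: measurable_affine_preimage.
transitivity (\int[std_gaussian p]_y
    (\1_(dot (w \o lift ord0) @^-1` [set s | B (w ord0 * a + s)]) y)%:E)%E.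
  apply: eq_integral => y _; rewrite !indicE; congr ((_ : bool)%:R%:E).
  rewrite /dot /=.
  have E : \sum_(i < p.+1) w i * tnth [tuple of a :: y] i =
    w ord0 * a + \sum_(i < p) w (lift ord0 i) * tnth y i.
    by rewrite big_ord_recl; congr (_ + _); apply: eq_bigr => i _; rewrite tnthS.
  by apply/idP/idP; rewrite !inE /= E.
rewrite integral_indic ?setIT//; apply: measurable_preimage.
  exact: measurable_dot.
exact: measurable_affine_preimage.
Qed.

(** A deterministic map of a Gaussian pair: the random scalar [z.1] multiplies
    the fixed direction [w], which adds [w w^T] to the covariance. *)
Definition add_spike p (w : 'I_p -> R) (z : R * p.-tuple R) : p.-tuple R :=
  [tuple tnth z.2 i + z.1 * w i | i < p].

Lemma measurable_add_spike p (w : 'I_p -> R) :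
  measurable_fun [set: R * p.-tuple R] (add_spike w).
Proof.
apply/measurable_fun_tnthP => i.
rewrite (_ : _ \o _ = fun z : R * p.-tuple R => tnth z.2 i + z.1 * w i); last first.
  by apply/funext => z; rewrite /comp tnth_mktuple.
apply: measurable_funD; last by apply: measurable_funM.
by apply: (measurableT_comp (measurable_tnth i)).
Qed.

HB.instance Definition _ p (w : 'I_p -> R) :=
  isMeasurableFun.Build _ _ _ _ (add_spike w) (measurable_add_spike w).

Definition spiked_gaussian p (w : 'I_p -> R) : probability (p.-tuple R) R :=
  distribution (gauss \x std_gaussian p)%E (add_spike w).

Lemma dot_add_spike p (v w : 'I_p -> R) z :
  dot v (add_spike w z) = (\sum_(i < p) v i * w i) * z.1 + dot v z.2.
Proof.
rewrite /dot mulr_suml -big_split; apply: eq_bigr => i _ /=.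
by rewrite tnth_mktuple; ring.
Qed.

Lemma spiked_gaussian_dot p (v w : 'I_p -> R) (B : set R) : measurable B ->
  spiked_gaussian w (dot v @^-1` B) =
  centred_normal (\sum_(i < p) v i ^+ 2 + (\sum_(i < p) v i * w i) ^+ 2) B.
Proof.
move=> mB; rewrite addrC -gauss_convolution//; last first.
  by apply: sumr_ge0 => i _; exact: sqr_ge0.
transitivity (\int[gauss]_a
    std_gaussian p (xsection (add_spike w @^-1` (dot v @^-1` B)) a))%E => //.
apply: eq_integral => a _.
rewrite -std_gaussian_dot; last exact: measurable_affine_preimage.
rewrite /=; congr (std_gaussian p _).
by apply/seteqP; split => x; rewrite /xsection/= inE /= dot_add_spike.
Qed.

(** The density of N(0, I + w w^T) with respect to N(0, I): with [q = |w|^2],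
    the determinant is [1 + q] and the inverse covariance is
    [I - w w^T / (1 + q)]. *)
Definition spike_density p (w : 'I_p -> R) (x : p.-tuple R) : R :=
  let q := \sum_(i < p) w i ^+ 2 in
  (Num.sqrt (1 + q))^-1 * expR (dot w x ^+ 2 / (2 * (1 + q))).

Lemma measurable_spike_density p (w : 'I_p -> R) :
  measurable_fun [set: p.-tuple R] (spike_density w).
Proof.
apply: measurable_funM => //; apply: measurableT_comp => //.
by apply: measurable_funM => //; apply: measurable_funX; exact: measurable_dot.
Qed.

Lemma spike_density_ge0 p (w : 'I_p -> R) x : 0 <= spike_density w x.
Proof. by rewrite mulr_ge0 ?expR_ge0// invr_ge0. Qed.

(** Conditionally on the scalar [g], the vector is a translate by [g w] of a
    standard one, with density [e g] below; the Gaussian average of [e g] over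
    [g] is [spike_density w]. *)
Lemma integral_spiked_gaussian p (w : 'I_p -> R) (h : p.-tuple R -> \bar R) :
  measurable_fun [set: p.-tuple R] h -> (forall x, 0 <= h x)%E ->
  (\int[spiked_gaussian w]_x h x =
   \int[std_gaussian p]_x (h x * (spike_density w x)%:E))%E.
Proof.
move=> mh h0; rewrite ge0_integral_distribution//.
rewrite fubini_tonelli1//=; last by apply: measurableT_comp.
pose e g (x : p.-tuple R) := expR (dot w x * g - (\sum_(i < p) w i ^+ 2) / 2 * g ^+ 2).
transitivity (\int[gauss]_g \int[std_gaussian p]_x (h x * (e g x)%:E))%E.
  apply: eq_integral => g _; rewrite /fubini_F /comp.
  rewrite [LHS](@tuple_prod_change _ _ _ _ (fun=> gauss) (fun=> gauss)
    (fun i x => x + g * w i)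
    (fun i x => expR (g * w i * x - (g * w i) ^+ 2 / 2)))//.
  - apply: eq_integral => x _; congr (_ * _%:E)%E.
    rewrite -expR_sum /e; congr expR.
    rewrite /dot mulr_suml !mulr_suml -sumrB; apply: eq_bigr => i _.
    by field.
  - by move=> i; exact: measurable_funD.
  - move=> i; apply: measurableT_comp => //.
    by apply: measurable_funB => //; exact: measurable_funM.
  - by move=> i k mk k0; rewrite integral_gauss_shift.
rewrite (@fubini_tonelli _ _ _ _ _ gauss (std_gaussian p)
   (fun z => (h z.2 * (e z.1 z.2)%:E)%E))/=; last 2 first.
- apply: emeasurable_funM; first exact: measurableT_comp.
  apply/measurable_EFinP/measurableT_comp => //.
  apply: measurable_funB.
    by apply: measurable_funM => //; apply: (measurableT_comp (measurable_dot w)).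
  by apply: measurable_funM => //; exact: measurable_funX.
- by move=> z; rewrite mule_ge0 // lee_fin expR_ge0.
have q0 : 0 <= \sum_(i < p) w i ^+ 2 by apply: sumr_ge0 => i _; exact: sqr_ge0.
apply: eq_integral => x _; rewrite ge0_integralZl//.
- by rewrite integral_gauss_expR//; apply: ltr_wpDr.
- apply/measurable_EFinP/measurableT_comp => //.
  apply: measurable_funB; first exact: measurable_funM.
  by apply: measurable_funM => //; exact: measurable_funX.
- by move=> g _; rewrite lee_fin expR_ge0.
Qed.

(** The integral is the mean of [spike_density v] under the law with density
    [spike_density w].  The former depends on [x] through the linear form
    [dot v x] only, which under the latter law is normal with variance
    [zeta + t^2], where [t] is the inner product of [v] and [w].  So a single
    integral over the line remains. *)
Lemma spike_overlap p (v w : 'I_p -> R) (zeta : R) : 0 < zeta ->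
  \sum_(i < p) v i ^+ 2 = zeta -> \sum_(i < p) w i ^+ 2 = zeta ->
  (\sum_(i < p) v i * w i) ^+ 2 < 1 ->
  (\int[std_gaussian p]_x (spike_density v x * spike_density w x)%:E =
   ((Num.sqrt (1 - (\sum_(i < p) v i * w i) ^+ 2))^-1)%:E)%E.
Proof.
move=> z0 vz wz t1; set t := \sum_(i < p) _ in t1 *.
transitivity (\int[spiked_gaussian w]_x (spike_density v x)%:E)%E.
  rewrite integral_spiked_gaussian//.
  - by apply/measurable_EFinP; exact: measurable_spike_density.
  - by move=> x; rewrite lee_fin spike_density_ge0.
pose k (s : R) : \bar R :=
  ((Num.sqrt (1 + zeta))^-1 * expR (s ^+ 2 / (2 * (1 + zeta))))%:E.
have mk : measurable_fun setT k.
  apply/measurable_EFinP/measurable_funM => //; apply: measurableT_comp => //.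
  by apply: measurable_funM => //; exact: measurable_funX.
have k0 s : (0 <= k s)%E.
  by rewrite lee_fin mulr_ge0 ?expR_ge0// invr_ge0.
have st0 : 0 < zeta + t ^+ 2 by rewrite ltr_wpDr ?sqr_ge0.
have sq0 : 0 < Num.sqrt (zeta + t ^+ 2) by rewrite sqrtr_gt0.
have msq : measurable_fun setT (fun x : R => Num.sqrt (zeta + t ^+ 2) * x).
  exact: measurable_funM.
have z1 : 0 < 1 + zeta by rewrite addr_gt0.
have tt : 0 < 1 - t ^+ 2 by rewrite subr_gt0.
transitivity (\int[gauss]_x k (Num.sqrt (zeta + t ^+ 2) * x)%R)%E.
  apply: (etrans (y := \int[pushforward (spiked_gaussian w) (dot v)]_s k s)%E).
    apply/esym; apply: (etrans (ge0_integral_pushforward (measurable_dot v) _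
      measurableT mk _)) => //.
    by apply: eq_integral => x _; rewrite /k /= /spike_density vz.
  apply: (etrans _ (ge0_integral_pushforward msq gauss measurableT mk _)) => //.
  apply: eq_measure_integral => [|mv A mA _]; first exact: measurable_dot.
  rewrite -[LHS]/(spiked_gaussian w (dot v @^-1` A)) spiked_gaussian_dot//.
  by rewrite vz /centred_normal gt_eqF// -std_normal_scale.
transitivity (\int[gauss]_x (((Num.sqrt (1 + zeta))^-1)%:E *
    (expR (0 * x - (- ((zeta + t ^+ 2) / (1 + zeta))) / 2 * x ^+ 2))%:E))%E.
  apply: eq_integral => x _; rewrite /k EFinM; congr (_ * (expR _)%:E)%E.
  by rewrite exprMn sqr_sqrtr ?ltW//; field; rewrite gt_eqF.
have E : 1 + - ((zeta + t ^+ 2) / (1 + zeta)) = (1 - t ^+ 2) / (1 + zeta).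
  by field; rewrite gt_eqF.
rewrite ge0_integralZl_EFin//.
- rewrite integral_gauss_expR E ?divr_gt0// -EFinM; congr EFin.
  rewrite expr0n/= mul0r expR0 mulr1 sqrtrM ?ltW// sqrtrV ?ltW// invfM invrK.
  by rewrite mulrCA mulVf ?mulr1// gt_eqF// sqrtr_gt0.
- apply/measurable_EFinP/measurableT_comp => //.
  apply: measurable_funB; first exact: measurable_funM.
  by apply: measurable_funM => //; exact: measurable_funX.
Qed.

Lemma integral_spike_density p (w : 'I_p -> R) :
  (\int[std_gaussian p]_x (spike_density w x)%:E = 1)%E.
Proof.
transitivity (\int[spiked_gaussian w]_x (cst 1%E x))%E.
  rewrite integral_spiked_gaussian//.
  by apply: eq_integral => x _; rewrite mul1e.
by rewrite integral_cst// mul1e; exact: probability_setT.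
Qed.

End Spike.

(** * Spiked covariance matrices and block sequences *)

Section SpikeCovariance.
Context (R : realType) (p : nat).
Implicit Types (w : 'I_p -> R) (x u : 'cV[R]_p).

Definition spike_cov w : 'M[R]_p := 1%:M + \matrix_(i, j) (w i * w j).

Lemma mul_spike w x i :
  ((\matrix_(i, j) (w i * w j)) *m x) i 0 = w i * \sum_j w j * x j 0.
Proof. by rewrite mxE mulr_sumr; apply: eq_bigr => j _; rewrite mxE mulrA. Qed.

Lemma quad_id u : (u^T *m 1%:M *m u) 0 0 = \sum_i u i 0 ^+ 2.
Proof. by rewrite mulmx1 mxE; apply: eq_bigr => i _; rewrite mxE expr2. Qed.

Lemma quad_spike_cov w u :
  (u^T *m spike_cov w *m u) 0 0 =
  \sum_i u i 0 ^+ 2 + (\sum_i u i 0 * w i) ^+ 2.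
Proof.
rewrite -mulmxA mulmxDl mulmxDr [LHS]mxE mulmxA quad_id; congr (_ + _).
rewrite mxE expr2 mulr_suml; apply: eq_bigr => i _.
rewrite mul_spike mxE mulrA; congr (_ * _).
by apply: eq_bigr => j _; rewrite mulrC.
Qed.

Lemma covariance_matrix1 : covariance_matrix (1%:M : 'M[R]_p).
Proof.
split=> [|u]; first by rewrite trmx1.
by rewrite quad_id sumr_ge0// => i _; exact: sqr_ge0.
Qed.

Lemma covariance_spike_cov w : covariance_matrix (spike_cov w).
Proof.
split=> [|u].
  by apply/matrixP => i j; rewrite !mxE eq_sym mulrC.
by rewrite quad_spike_cov addr_ge0 ?sqr_ge0// sumr_ge0// => i _; exact: sqr_ge0.
Qed.

Lemma l2norm_le1 x : (l2norm x <= 1) = (\sum_i x i 0 ^+ 2 <= 1).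
Proof. by rewrite /l2norm -{1}sqrtr1 ler_sqrt. Qed.

Lemma opnorm_attained (A : 'M[R]_p) (e : 'cV[R]_p) M :
  l2norm e <= 1 -> l2norm (A *m e) = M ->
  (forall x, l2norm x <= 1 -> l2norm (A *m x) <= M) -> opnorm A = M.
Proof.
move=> e1 eM Mub; apply/eqP; rewrite eq_le; apply/andP; split.
  apply: ge_sup; first by exists M, e.
  by move=> _ [x x1 <-]; exact: Mub.
apply: ub_le_sup; last by exists e.
by exists M => _ [x x1 <-]; exact: Mub.
Qed.

(** The Cauchy-Schwarz inequality, from the nonnegativity of the squared norm of
    the component of [zeta x] orthogonal to [w]. *)
Lemma cauchy_spike w zeta x : 0 < zeta -> \sum_i w i ^+ 2 = zeta ->
  (\sum_i w i * x i 0) ^+ 2 <= zeta * \sum_i x i 0 ^+ 2.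
Proof.
move=> z0 wz; have [c cE] : {c | \sum_i w i * x i 0 = c} by eexists.
rewrite cE; have : 0 <= \sum_i (zeta * x i 0 - c * w i) ^+ 2.
  by apply: sumr_ge0 => i _; exact: sqr_ge0.
have -> : \sum_i (zeta * x i 0 - c * w i) ^+ 2 =
    zeta * (zeta * (\sum_i x i 0 ^+ 2) - c ^+ 2).
  transitivity (zeta ^+ 2 * (\sum_i x i 0 ^+ 2) -
      2 * zeta * c * (\sum_i w i * x i 0) + c ^+ 2 * \sum_i w i ^+ 2); last first.
    by rewrite wz cE; ring.
  rewrite !mulr_sumr -sumrB -big_split; apply: eq_bigr => i _ /=.
  ring.
by rewrite pmulr_rge0// subr_ge0.
Qed.

(** The maximum is attained at the unit vector along [w].  Taking [a = 1] gives
    the norm of a spiked covariance matrix, taking [a = 0] that of its jump from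
    the identity. *)
Lemma opnorm_spike w (a zeta : R) : 0 <= a -> 0 < zeta ->
  \sum_i w i ^+ 2 = zeta ->
  opnorm (a%:M + \matrix_(i, j) (w i * w j)) = a + zeta.
Proof.
move=> a0 z0 wz.
have E x i : ((a%:M + \matrix_(i, j) (w i * w j)) *m x) i 0 =
    a * x i 0 + w i * \sum_j w j * x j 0.
  by rewrite mulmxDl mxE mul_scalar_mx mxE mul_spike.
have sz0 : 0 < Num.sqrt zeta by rewrite sqrtr_gt0.
have sqz : Num.sqrt zeta ^+ 2 = zeta by rewrite sqr_sqrtr ?ltW//.
have az : 0 <= a + zeta by rewrite addr_ge0// ltW.
pose e : 'cV[R]_p := \col_i (w i / Num.sqrt zeta).
have e1 : \sum_i e i 0 ^+ 2 = 1.
  rewrite (eq_bigr (fun i => w i ^+ 2 / zeta)) => [|i _].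
    by rewrite -mulr_suml wz divff ?gt_eqF//.
  by rewrite mxE exprMn exprVn sqz.
have we : \sum_j w j * e j 0 = Num.sqrt zeta.
  rewrite (eq_bigr (fun i => w i ^+ 2 / Num.sqrt zeta)) => [|i _].
    by rewrite -mulr_suml wz -{1}sqz expr2 mulfK ?gt_eqF//.
  by rewrite mxE; ring.
apply: (@opnorm_attained _ e).
- by rewrite l2norm_le1 e1.
- rewrite /l2norm (eq_bigr (fun i => (a + zeta) ^+ 2 * e i 0 ^+ 2)) => [|i _].
    by rewrite -mulr_sumr e1 mulr1 sqrtr_sqr ger0_norm.
  rewrite E we -exprMn; congr (_ ^+ 2); rewrite !mxE mulrDl; congr (_ + _).
  by rewrite -{2}sqz; field; rewrite gt_eqF.
move=> x; rewrite l2norm_le1 => x1.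
rewrite -[leRHS]ger0_norm// -sqrtr_sqr /l2norm ler_sqrt ?sqr_ge0//.
set c := \sum_j w j * x j 0.
rewrite (eq_bigr (fun i => a ^+ 2 * x i 0 ^+ 2 + 2 * a * c * (w i * x i 0) +
  c ^+ 2 * w i ^+ 2)) => [|i _]; last by rewrite E -/c; ring.
rewrite !big_split /= -!mulr_sumr wz -/c.
have := cauchy_spike x z0 wz; rewrite -/c.
set X := \sum_i x i 0 ^+ 2 in x1 *; move=> cX.
have X0 : 0 <= X by apply: sumr_ge0 => i _; exact: sqr_ge0.
apply: (@le_trans _ _ ((a + zeta) ^+ 2 * X)); last first.
  by rewrite ler_piMr ?sqr_ge0.
have -> : (a + zeta) ^+ 2 * X = a ^+ 2 * X + (2 * a + zeta) * (zeta * X) by ring.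
have -> : a ^+ 2 * X + 2 * a * c * c + c ^+ 2 * zeta =
  a ^+ 2 * X + (2 * a + zeta) * c ^+ 2 by ring.
by rewrite lerD2l ler_wpM2l// addr_ge0 ?mulr_ge0// ltW.
Qed.

Lemma opnormN (A : 'M[R]_p) : opnorm (- A) = opnorm A.
Proof.
have l2N (x : 'cV[R]_p) : l2norm (- x) = l2norm x.
  by rewrite /l2norm; congr Num.sqrt; apply: eq_bigr => i _; rewrite mxE sqrrN.
congr sup; apply/seteqP; split => _ [x x1 <-]; exists x => //.
  by rewrite mulNmx l2N.
by rewrite mulNmx l2N.
Qed.

End SpikeCovariance.

Section BlockSequence.
Context (R : realType) (n p : nat).

(** The positions [t] are 0-based here, so that the change-points, which are
    1-based, are [a.+1] and [b.+1]. *)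
Definition block_seq (S : 'M[R]_p) (a b : nat) : n.-tuple 'M[R]_p :=
  [tuple if a <= t < b then S else 1%:M | t < n]%N.

Lemma cov_at_block_seq S a b t : (0 < t <= n)%N ->
  cov_at (block_seq S a b) t = if (a <= t.-1 < b)%N then S else 1%:M.
Proof.
move=> tn; have tn' : (t.-1 < n)%N by lia.
by rewrite /cov_at -(tnth_nth 0 _ (Ordinal tn')) tnth_mktuple.
Qed.

Lemma change_points_block_seq S a b : S != 1%:M -> (0 < a < b)%N -> (b < n)%N ->
  change_points (block_seq S a b) = [:: a.+1; b.+1].
Proof.
move=> S1 ab bn; apply: (irr_sorted_eq ltn_trans ltnn).
- by apply: sorted_filter; [exact: ltn_trans|exact: iota_ltn_sorted].
- by rewrite /= andbT; lia.
move=> t; rewrite mem_filter mem_index_iota !inE.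
have [tn|tn] := boolP (2 <= t < n.+1)%N; last by rewrite andbF; lia.
rewrite andbT !cov_at_block_seq; [|lia|lia].
case: ifPn => h1; case: ifPn => h2; rewrite ?eqxx ?S1 ?(eq_sym 1%:M) ?S1 /=; lia.
Qed.

(** The three bounds on [a] and [b] make the lengths of the three segments at
    least [r]. *)
Lemma Pbar_block_seq (r a b : nat) (zeta : R) (w : 'I_p -> R) :
  0 < zeta -> \sum_i w i ^+ 2 = zeta -> (0 < r)%N ->
  (r <= a)%N -> (a + r <= b)%N -> (b + r <= n)%N ->
  nb_changes (block_seq (spike_cov w) a b) = 2%N /\
  Pbar r zeta (block_seq (spike_cov w) a b).
Proof.
move=> z0 wz r0 ra ab bn.
have S1 : spike_cov w != 1%:M.
  apply/eqP => S1; have := quad_spike_cov w (\col_i w i).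
  rewrite S1 quad_id => /eqP; rewrite eq_sym -subr_eq0 addrC addKr sqrf_eq0.
  rewrite (eq_bigr (fun i => w i ^+ 2)) => [|i _]; last by rewrite mxE expr2.
  by rewrite wz gt_eqF.
have CP : change_points (block_seq (spike_cov w) a b) = [:: a.+1; b.+1].
  by apply: change_points_block_seq => //; lia.
have nb : nb_changes (block_seq (spike_cov w) a b) = 2%N.
  by rewrite /nb_changes CP.
have opS : opnorm (spike_cov w - 1%:M) = zeta.
  have := @opnorm_spike _ _ w 0 zeta (lexx _) z0 wz.
  by rewrite add0r raddf0 add0r => <-; rewrite /spike_cov addrC addKr.
split=> //; split.
- move=> t; rewrite tnth_mktuple; case: ifP => _.
    exact: covariance_spike_cov.
  exact: covariance_matrix1.
- move=> t; rewrite tnth_mktuple; case: ifP => _; [right|by left].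
  exact: opnorm_spike.
- rewrite nb /segment_length /change_point CP => k k2.
  have [->|->] : k = 1%N \/ k = 2%N by lia.
  + by rewrite /=; lia.
  + by rewrite /=; lia.
rewrite nb /change_point CP => k k2.
have [->|->] : k = 1%N \/ k = 2%N by lia.
- rewrite /= !cov_at_block_seq; [|lia|lia].
  rewrite /= (_ : (a <= a < b)%N = true) 1?(_ : (a <= 0 < b)%N = false) ?opS//; lia.
- rewrite /= !cov_at_block_seq; [|lia|lia].
  rewrite /= (_ : (a <= b < b)%N = false) 1?(_ : (a <= a < b)%N = true); [|lia|lia].
  by rewrite -opnormN opprB opS.
Qed.

Lemma Pbar_constant (r : nat) (zeta : R) :
  nb_changes (block_seq (1%:M : 'M[R]_p) 0 0) = 0%N /\
  Pbar r zeta (block_seq (1%:M : 'M[R]_p) 0 0).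
Proof.
have nb : nb_changes (block_seq (1%:M : 'M[R]_p) 0 0) = 0%N.
  rewrite /nb_changes /change_points (@eq_in_filter _ _ pred0) ?filter_pred0//.
  move=> t; rewrite mem_index_iota => tn.
  by rewrite !cov_at_block_seq; [rewrite !ltn0 !andbF eqxx|lia|lia].
split=> //; split.
- by move=> t; rewrite tnth_mktuple ltn0 andbF; exact: covariance_matrix1.
- by move=> t; rewrite tnth_mktuple ltn0 andbF; left.
- by rewrite nb => -[|k].
- by rewrite nb => -[|k].
Qed.

End BlockSequence.

(** * Average overlap of random sign directions *)

Section Overlap.
Context (R : realType).
Local Notation gauss := (std_normal R).

Lemma invr_le_expR (y : R) : 0 <= y <= 1 / 2 -> (1 - y)^-1 <= expR (2 * y).
Proof.
move=> /andP[y0 y1]; apply: (le_trans _ (expR_ge1Dx _)).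
by rewrite -[leLHS]mul1r ler_pdivrMr; nra.
Qed.

(** The optimal constant in the exponent is 1/2 instead of 2; this one has a
    short proof.  For [t >= 1/2] both exponentials are at most
    [exp(2 t^2)]; for smaller [t] the bound [exp s <= 1 / (1 - s)] makes the
    left-hand side at most [2 / (1 - t^2)]. *)
Lemma cosh_le (t : R) : expR t + expR (- t) <= 2 * expR (2 * t ^+ 2).
Proof.
wlog t0 : t / 0 <= t.
  move=> H; have [/H//|/ltW t0] := leP 0 t.
  by have := H (- t); rewrite opprK sqrrN addrC; apply; rewrite oppr_ge0.
have [t1|t1] := leP (1 / 2) t.
  have : expR t <= expR (2 * t ^+ 2) by rewrite ler_expR; nra.
  have : expR (- t) <= expR (2 * t ^+ 2) by rewrite ler_expR; nra.
  by lra.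
have tinv (s : R) : s < 1 -> expR s <= (1 - s)^-1.
  move=> s1; rewrite -[expR s]invrK -expRN lef_pV2 ?posrE ?expR_gt0 ?subr_gt0//.
  exact: expR_ge1Dx.
have t2 : t ^+ 2 <= 1 / 2 by nra.
have h : expR t + expR (- t) <= (1 - t)^-1 + (1 + t)^-1.
  by apply: lerD; [apply: tinv; lra|rewrite -{2}[t]opprK; apply: tinv; lra].
apply: (le_trans h).
have -> : (1 - t)^-1 + (1 + t)^-1 = 2 * (1 - t ^+ 2)^-1.
  by field; apply/and3P; split; apply/eqP; nra.
rewrite ler_pM2l//; apply: invr_le_expR; rewrite t2 andbT; exact: sqr_ge0.
Qed.

Lemma rsqrt_le_expR (y : R) : 0 <= y <= 1 / 2 ->
  (Num.sqrt (1 - y))^-1 <= expR y.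
Proof.
move=> y01; have y1 : 0 < 1 - y by move/andP: y01 => [? ?]; lra.
rewrite -ler_sqr ?nnegrE ?invr_ge0 ?expR_ge0//.
rewrite exprVn sqr_sqrtr ?(ltW y1)// -expRM_natl.
exact: invr_le_expR.
Qed.

(** [p] times the inner product of the unit vectors with signs [e] and [f]. *)
Definition sgn_corr p (e f : {ffun 'I_p -> bool}) : R :=
  \sum_(i < p) (-1) ^+ e i * (-1) ^+ f i.

(** The signs of [e] are independent, so the sum factors over coordinates,
    whatever [f] is. *)
Lemma sum_expR_sgn_corr p (f : {ffun 'I_p -> bool}) (t : R) :
  \sum_(e : {ffun 'I_p -> bool}) expR (t * sgn_corr e f) <=
  2 ^+ p * expR (2 * p%:R * t ^+ 2).
Proof.
under eq_bigr do rewrite mulr_sumr expR_sum.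
rewrite -(bigA_distr_bigA (fun i (b : bool) => expR (t * ((-1) ^+ b * (-1) ^+ f i)))) /=.
apply: (@le_trans _ _ (\prod_(i < p) (2 * expR (2 * t ^+ 2)))).
  apply: ler_prod => i _; rewrite big_bool /= addr_ge0 ?expR_ge0//=.
  apply: le_trans (cosh_le t).
  case: (f i); rewrite /= ?expr1 ?expr0 ?mulr1 ?mul1r ?mulrNN ?mulr1 ?mulrN1 //.
  by rewrite addrC.
rewrite prodr_const card_ord exprMn ler_pM2l ?exprn_gt0//.
by rewrite -expRM_natl ler_expR mulrCA mulrA.
Qed.

(** The exponential of the square is a Gaussian average of exponentials of
    linear functions of the correlation, to which [sum_expR_sgn_corr] applies
    under the integral sign.  What remains is the mean of [exp(g^2/4)] for a
    standard normal [g], equal to [sqrt 2]; the constant 16 is what makes this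
    exponent smaller than 1/2. *)
Lemma sum_expR_sgn_corr_sqr p (f : {ffun 'I_p -> bool}) : (0 < p)%N ->
  \sum_(e : {ffun 'I_p -> bool}) expR ((sgn_corr e f) ^+ 2 / (16 * p%:R)) <=
  2 ^+ p * Num.sqrt 2.
Proof.
move=> p0; have p1 : 0 < p%:R :> R by rewrite ltr0n.
(* [s] is chosen so that [(s c)^2 / 2 = c^2 / (16 p)]. *)
pose s : R := Num.sqrt (1 / (8 * p%:R)).
have s2 : s ^+ 2 = 1 / (8 * p%:R) by rewrite sqr_sqrtr// divr_ge0// mulr_ge0// ltW.
rewrite -lee_fin -sumEFin.
have me k b : measurable_fun setT (fun g : R => (expR (k * g - b / 2 * g ^+ 2))%:E).
  apply/measurable_EFinP/measurableT_comp => //.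
  apply: measurable_funB; first exact: measurable_funM.
  by apply: measurable_funM => //; exact: measurable_funX.
rewrite (eq_bigr (fun e => \int[gauss]_g
    (expR ((s * sgn_corr e f) * g - 0 / 2 * g ^+ 2))%:E)%E) => [|e _]; last first.
  rewrite integral_gauss_expR; last by rewrite addr0.
  rewrite addr0 sqrtr1 invr1 mul1r exprMn s2; congr (expR _)%:E.
  by field; rewrite gt_eqF.
rewrite -ge0_integral_sum//.
have -> : Num.sqrt 2 = (Num.sqrt (1 + (- (1 / 2))))^-1 *
    expR (0 ^+ 2 / (2 * (1 + (- (1 / 2 : R))))) :> R.
  rewrite expr0n mul0r expR0 mulr1 -sqrtrV; last by lra.
  by congr Num.sqrt; field.
rewrite EFinM -integral_gauss_expR; last by lra.
rewrite -ge0_integralZl_EFin//.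
apply: ge0_le_integral => //.
- by move=> g _; rewrite sumEFin lee_fin sumr_ge0// => e _; exact: expR_ge0.
- by apply: emeasurable_sum => e; exact: me.
- by apply: emeasurable_funM => //; exact: me.
move=> g _; rewrite sumEFin -EFinM lee_fin.
rewrite (eq_bigr (fun e => expR (s * g * sgn_corr e f))) => [|e _]; last first.
  by congr expR; ring.
apply: (le_trans (sum_expR_sgn_corr f (s * g))).
rewrite ler_pM2l ?exprn_gt0// ler_expR exprMn s2 le_eqVlt; apply/orP; left.
by apply/eqP; field; rewrite gt_eqF.
Qed.

Lemma sgn_corr_le p (e f : {ffun 'I_p -> bool}) : (sgn_corr e f) ^+ 2 <= p%:R ^+ 2.
Proof.
rewrite -[leLHS]real_normK ?num_real// ler_sqr ?nnegrE//.
apply: (le_trans (ler_norm_sum _ _ _)).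
rewrite (eq_bigr (fun=> 1)) ?sumr_const ?card_ord// => i _.
by rewrite normrM !normrX normrN1 !expr1n mulr1.
Qed.

(** With [x = n / r >= 4] and [w = x^(1/4)], both factors on the left are at most
    [w], and [w^2 <= w^4 - 2 = x - 2] because [w^2 >= 2]. *)
Lemma block_count_bound (n r : nat) : (0 < r)%N -> r%:R <= n%:R / 4 :> R ->
  Num.sqrt 2 * expR (ln (n%:R / r%:R) / 16) <= (n %/ r - 2).+1%:R :> R.
Proof.
move=> r0 rn; have r1 : 0 < r%:R :> R by rewrite ltr0n.
set x : R := n%:R / r%:R.
have x4 : 4 <= x by rewrite /x ler_pdivlMr// ; lra.
have x0 : 0 < x by lra.
pose w := expR (ln x / 4).
have w4 : w ^+ 4 = x by rewrite -expRM_natl mulrCA divff// mulr1 lnK// posrE.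
have w0 : 0 < w by exact: expR_gt0.
have w2 : 2 <= w ^+ 2.
  rewrite -ler_sqr ?nnegrE ?exprn_ge0 ?(ltW w0)// -exprM w4.
  by rewrite expr2; lra.
have sw : Num.sqrt 2 <= w.
  by rewrite -[leRHS]ger0_norm ?(ltW w0)// -sqrtr_sqr ler_sqrt// sqr_ge0.
have ew : expR (ln x / 16) <= w.
  by rewrite ler_expR; have := ln_ge0 (le_trans _ x4); lra.
have n4 : (4 * r <= n)%N by rewrite -(ler_nat R) natrM; lra.
have xm : x < (n %/ r).+1%:R.
  by rewrite ltr_pdivrMr// -natrM ltr_nat ltn_ceil.
have q4 : (4 <= n %/ r)%N by rewrite leq_divRL.
have qE : (n %/ r).+1%:R = (n %/ r - 2).+1%:R + 2 :> R.
  by rewrite -natrD; congr _%:R; lia.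
have : Num.sqrt 2 * expR (ln x / 16) <= w * w.
  by apply: ler_pM => //; exact: expR_ge0.
have : w ^+ 4 = w ^+ 2 * w ^+ 2 by rewrite -exprD.
rewrite w4 -expr2; nra.
Qed.

(** [(1 - y)^(-1/2) <= exp y] for [y <= 1/2] bounds the overlap by
    [exp(r zeta^2 rho^2)], with [rho] the inner product of the two directions.
    The hypothesis splits this exponent into [p rho^2 / 16], which is averaged,
    and a part which is at most [ln(n/r) / 16] because [rho^2 <= 1]. *)
Lemma overlap_bound (n p r : nat) (zeta : R) (f : {ffun 'I_p -> bool}) :
  (1 <= p)%N -> (1 <= r)%N -> r%:R <= n%:R / 4 :> R -> 0 < zeta ->
  zeta ^+ 2 <= 1 / 2 ->
  r%:R * zeta ^+ 2 <= 1 / 16 * (p%:R + ln (n%:R / r%:R)) ->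
  \sum_(e : {ffun 'I_p -> bool})
    (Num.sqrt (1 - (zeta / p%:R * sgn_corr e f) ^+ 2))^-1 ^+ r <=
  2 ^+ p * (n %/ r - 2).+1%:R.
Proof.
move=> p1 r1 rn z0 z2 rz.
have p0 : 0 < p%:R :> R by rewrite ltr0n.
have r0 : 0 < r%:R :> R by rewrite ltr0n.
set L := ln (n%:R / r%:R) in rz *.
have L0 : 0 <= L.
  by apply: ln_ge0; rewrite ler_pdivlMr//; lra.
apply: (@le_trans _ _ (\sum_(e : {ffun 'I_p -> bool})
    expR ((sgn_corr e f) ^+ 2 / (16 * p%:R)) * expR (L / 16))).
  apply: ler_sum => e _.
  pose rho := sgn_corr e f / p%:R.
  have rho1 : rho ^+ 2 <= 1.
    by rewrite /rho exprMn exprVn ler_pdivrMr ?exprn_gt0// mul1r sgn_corr_le.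
  have rho0 : 0 <= rho ^+ 2 by exact: sqr_ge0.
  have -> : (zeta / p%:R * sgn_corr e f) ^+ 2 = zeta ^+ 2 * rho ^+ 2.
    by rewrite /rho; field; rewrite gt_eqF.
  have y01 : 0 <= zeta ^+ 2 * rho ^+ 2 <= 1 / 2.
    by rewrite mulr_ge0 ?sqr_ge0//=; have := sqr_ge0 zeta; nra.
  apply: (@le_trans _ _ (expR (zeta ^+ 2 * rho ^+ 2) ^+ r)).
    by rewrite lerXn2r ?nnegrE ?invr_ge0 ?expR_ge0//; exact: rsqrt_le_expR.
  rewrite -expRM_natl -expRD ler_expR.
  have -> : sgn_corr e f ^+ 2 / (16 * p%:R) = p%:R / 16 * rho ^+ 2.
    by rewrite /rho; field; rewrite gt_eqF.
  have : r%:R * zeta ^+ 2 * rho ^+ 2 <= 1 / 16 * (p%:R + L) * rho ^+ 2.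
    by rewrite ler_wpM2r.
  by nra.
rewrite -mulr_suml.
apply: (@le_trans _ _ (2 ^+ p * Num.sqrt 2 * expR (L / 16))).
  by rewrite ler_wpM2r ?expR_ge0// sum_expR_sgn_corr_sqr.
by rewrite -mulrA ler_wpM2l ?exprn_ge0// block_count_bound.
Qed.

End Overlap.

(** * Le Cam's method for a mixture *)

Section LeCam.
Context d (T : measurableType d) (R : realType) (K : finType).
Variables (P0 : probability T R) (P : K -> probability T R) (L : K -> T -> R).
Hypotheses (mL : forall k, measurable_fun setT (L k))
  (L0 : forall k y, 0 <= L k y).
Hypothesis PL : forall k A, measurable A ->
  P k A = (\int[P0]_y ((\1_A y)%:E * (L k y)%:E))%E.
Hypothesis K0 : (0 < #|K|)%N.
Hypothesis chi2 : forall k',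
  (\sum_(k : K) \int[P0]_y (L k y * L k' y)%:E <= (2 * #|K|%:R)%:E)%E.

Let N : R := #|K|%:R.
Let N0 : 0 < N. Proof. by rewrite ltr0n. Qed.
Let iN0 : (0 <= (N^-1)%:E)%E. Proof. by rewrite lee_fin invr_ge0 ltW. Qed.
Let g y := N^-1 * \sum_k L k y.

Let g0 y : 0 <= g y.
Proof. by rewrite mulr_ge0 ?invr_ge0 ?ler0n// sumr_ge0. Qed.

Let mg : measurable_fun setT g.
Proof. by apply: measurable_funM => //; exact: measurable_sum. Qed.

Let integral_mixture (h : T -> R) :
  measurable_fun setT h -> (forall y, 0 <= h y) ->
  (\int[P0]_y (h y * g y)%:E =
   (N^-1)%:E * \sum_(k : K) \int[P0]_y (h y * L k y)%:E)%E.
Proof.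
move=> mh h0.
rewrite -ge0_integral_sum//; first last.
- by move=> k y _; rewrite lee_fin mulr_ge0.
- by move=> k; apply/measurable_EFinP; exact: measurable_funM.
rewrite -ge0_integralZl_EFin//; first last.
- by apply: emeasurable_sum => k; apply/measurable_EFinP; exact: measurable_funM.
- by move=> y _; rewrite sumEFin lee_fin sumr_ge0// => k _; rewrite mulr_ge0.
apply: eq_integral => y _; rewrite sumEFin -EFinM; congr EFin.
by rewrite -mulr_sumr mulrCA.
Qed.

(** If both kinds of error were below 1/4, integrating
    [g <= 1_A + 1_(~A) g + g^2 / 4] against [P0] would give
    [1 < 1/4 + 1/4 + 2/4].  The second moment of [g] is handled by expanding one
    of its two factors at a time. *)
Lemma le_cam (A : set T) : measurable A ->
  ((1 / 4)%:E <= P0 A)%E \/ exists k, ((1 / 4)%:E <= P k (~` A))%E.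
Proof.
move=> mA; have mAC : measurable (~` A) by exact: measurableC.
apply: contrapT => /not_orP[/negP]; rewrite -ltNge => hA /forallNP hP.
have {}hP k : (P k (~` A) < (1 / 4)%:E)%E by rewrite ltNge; apply/negP.
have mi (B : set T) : measurable B -> measurable_fun setT (\1_B : T -> R).
  by move=> mB; exact: measurable_indic.
have Ig : (\int[P0]_y (g y)%:E = 1)%E.
  transitivity (\int[P0]_y (cst 1 y * g y)%:E)%E.
    by apply: eq_integral => y _; rewrite mul1r.
  rewrite integral_mixture// (eq_bigr (fun=> 1%:E)) => [|k _]; last first.
    rewrite -(probability_setT (P k)) PL//; apply: eq_integral => y _.
    by rewrite -EFinM indicT.
  by rewrite sumEFin sumr_const -EFinM mulVf// gt_eqF.
have Igg : (\int[P0]_y (g y * g y)%:E <= 2%:E)%E.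
  rewrite integral_mixture// -[leRHS](_ : (N^-1)%:E * (2 * N)%:E = _)%E; last first.
    by rewrite -EFinM mulrCA mulVf ?mulr1// gt_eqF.
  rewrite lee_wpmul2l//.
  apply: (@le_trans _ _ (\sum_(k : K) 2%:E)%E); last first.
    by rewrite sumEFin sumr_const lee_fin -[leLHS]mulr_natr.
  apply: lee_sum => k _.
  rewrite (eq_integral (fun y => (L k y * g y)%:E)); last first.
    by move=> y _; rewrite mulrC.
  rewrite integral_mixture// -[leRHS](_ : (N^-1)%:E * (2 * N)%:E = _)%E; last first.
    by rewrite -EFinM mulrCA mulVf ?mulr1// gt_eqF.
  rewrite lee_wpmul2l//.
  rewrite (eq_bigr (fun k' => \int[P0]_y (L k' y * L k y)%:E)%E) => [|k' _].
    exact: chi2.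
  by apply: eq_integral => y _; rewrite mulrC.
have IA : (\int[P0]_y (\1_A y)%:E < (1 / 4)%:E)%E by rewrite integral_indic// setIT.
have IAC : (\int[P0]_y (\1_(~` A) y * g y)%:E <= (1 / 4)%:E)%E.
  rewrite integral_mixture//.
  rewrite -[leRHS](_ : (N^-1)%:E * (1 / 4 * N)%:E = _)%E; last first.
    by rewrite -EFinM mulrCA mulVf ?mulr1// gt_eqF.
  rewrite lee_wpmul2l//.
  apply: (@le_trans _ _ (\sum_(k : K) (1 / 4)%:E)%E); last first.
    by rewrite sumEFin sumr_const lee_fin -[leLHS]mulr_natr.
  apply: lee_sum => k _; apply: ltW; apply: le_lt_trans (hP k).
  by rewrite PL//.
have mA1 : measurable_fun setT (fun y => (\1_A y)%:E : \bar R).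
  by apply/measurable_EFinP; exact: mi.
have mA2 : measurable_fun setT (fun y => (\1_(~` A) y * g y)%:E).
  by apply/measurable_EFinP/measurable_funM => //; exact: mi.
have mgg : measurable_fun setT (fun y => (g y * g y)%:E).
  by apply/measurable_EFinP; exact: measurable_funM.
have : (\int[P0]_y (g y)%:E <= \int[P0]_y ((\1_A y)%:E +
    ((\1_(~` A) y * g y)%:E + (1 / 4)%:E * (g y * g y)%:E)))%E.
  apply: ge0_le_integral => //.
  - by move=> y _; rewrite lee_fin.
  - by apply/measurable_EFinP.
  - apply: emeasurable_funD => //; apply: emeasurable_funD => //.
    exact: emeasurable_funM.
  move=> y _; rewrite -EFinM -!EFinD lee_fin !indicE in_setC.
  case: (y \in A) => /=; last by have := mulr_ge0 (g0 y) (g0 y); lra.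
  (* On [A] the claim is [g <= 1 + g^2 / 4]. *)
  by have := sqr_ge0 (g y / 2 - 1); nra.
apply/negP; rewrite -ltNge Ig.
have q0 : 0 <= 1 / 4 :> R by lra.
have t0 y : 0 <= \1_(~` A) y * g y by rewrite mulr_ge0.
have s0 y : 0 <= g y * g y by rewrite mulr_ge0.
rewrite ge0_integralD//; first last.
- by apply: emeasurable_funD => //; exact: emeasurable_funM.
- by move=> y _; rewrite adde_ge0// ?mule_ge0 ?lee_fin.
rewrite ge0_integralD//; first last.
- exact: emeasurable_funM.
- by move=> y _; rewrite mule_ge0 ?lee_fin.
- by move=> y _; rewrite lee_fin.
rewrite ge0_integralZl_EFin//; last by move=> y _; rewrite lee_fin.
rewrite (_ : 1%E = ((1 / 4)%:E + ((1 / 4)%:E + (1 / 4)%:E * 2%:E))%E); last first.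
  by rewrite -EFinM -!EFinD; congr EFin; field.
have bnd : (\int[P0]_y (\1_(~` A) y * g y)%:E + (1 / 4)%:E * \int[P0]_y (g y * g y)%:E <=
    (1 / 4)%:E + (1 / 4)%:E * 2%:E)%E.
  by apply: leeD => //; rewrite lee_wpmul2l// lee_fin.
apply: lte_leD => //.
rewrite ge0_fin_numE; first by apply: (le_lt_trans bnd); rewrite -EFinM -EFinD ltry.
apply: adde_ge0; first by apply: integral_ge0 => y _; rewrite lee_fin.
by rewrite mule_ge0 ?lee_fin//; apply: integral_ge0 => y _; rewrite lee_fin.
Qed.

End LeCam.

(** * Laws of the planted sequences and the lower bound *)

Section Laws.
Context (R : realType) (p : nat).

Lemma is_gaussian_std : is_gaussian 1%:M (std_gaussian R p).
Proof.
move=> u B mB; rewrite quad_id -(std_gaussian_dot (fun i => u i 0) mB).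
by [].
Qed.

Lemma is_gaussian_spiked (w : 'I_p -> R) :
  is_gaussian (spike_cov w) (spiked_gaussian w).
Proof.
move=> u B mB; rewrite quad_spike_cov.
by rewrite -(spiked_gaussian_dot (fun i => u i 0) w mB).
Qed.

Lemma is_law_tuple_prod n (eta : n.-tuple 'M[R]_p)
    (nu : 'I_n -> probability (p.-tuple R) R) :
  (forall t, is_gaussian (tnth eta t) (nu t)) -> is_law eta (tuple_prod nu).
Proof.
move=> gnu; split=> [t u B mB|A mA].
  rewrite -(gnu t u B mB) /pushforward.
  rewrite -(tuple_prod_proj nu t) //.
  exact: (measurable_preimage (measurable_dot (fun i => u i 0)) mB).
rewrite tuple_prod_box//; apply: eq_bigr => t _.
by rewrite tuple_prod_proj.
Qed.

End Laws.

Section BlockLaw.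
Context (R : realType) (n p : nat).
Implicit Types (w v : 'I_p -> R) (a b : nat).

(** An observation outside of the block is standard, so its factor in the
    likelihood ratio is 1; this is why [block_density] is constant there. *)
Definition block_law w a b (t : 'I_n) : probability (p.-tuple R) R :=
  if (a <= t < b)%N then spiked_gaussian w else std_gaussian R p.

Definition block_density w a b (t : 'I_n) (x : p.-tuple R) : R :=
  if (a <= t < b)%N then spike_density w x else 1.

Definition block_likelihood w a b (y : n.-tuple (p.-tuple R)) : R :=
  \prod_(t < n) block_density w a b t (tnth y t).

Lemma block_density_ge0 w a b t x : 0 <= block_density w a b t x.
Proof. by rewrite /block_density; case: ifP => // _; exact: spike_density_ge0. Qed.

Lemma measurable_block_density w a b t :
  measurable_fun setT (block_density w a b t).
Proof.
rewrite /block_density; case: (_ <= _ < _)%N => //.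
exact: measurable_spike_density.
Qed.

Lemma measurable_block_likelihood w a b :
  measurable_fun [set: n.-tuple (p.-tuple R)] (block_likelihood w a b).
Proof. by apply: measurable_prod_tnth => t; exact: measurable_block_density. Qed.

Lemma block_likelihood_ge0 w a b y : 0 <= block_likelihood w a b y.
Proof. by apply: prodr_ge0 => t _; exact: block_density_ge0. Qed.

Lemma is_law_block w a b :
  is_law (block_seq n (spike_cov w) a b) (tuple_prod (block_law w a b)).
Proof.
apply: is_law_tuple_prod => t; rewrite tnth_mktuple /block_law.
by case: ifP => _; [exact: is_gaussian_spiked|exact: is_gaussian_std].
Qed.

Lemma is_law_constant :
  is_law (block_seq n (1%:M : 'M[R]_p) 0 0)
    (tuple_prod (fun _ : 'I_n => std_gaussian R p)).
Proof.
apply: is_law_tuple_prod => t; rewrite tnth_mktuple ltn0 andbF.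
exact: is_gaussian_std.
Qed.

Lemma block_law_likelihood w a b (A : set (n.-tuple (p.-tuple R))) :
  measurable A ->
  tuple_prod (block_law w a b) A =
  (\int[tuple_prod (fun=> std_gaussian R p)]_y
    ((\1_A y)%:E * (block_likelihood w a b y)%:E))%E.
Proof.
move=> mA; rewrite /block_likelihood.
rewrite -(@tuple_prod_change _ _ _ _ (block_law w a b) (fun=> std_gaussian R p)
  (fun=> idfun) (block_density w a b) _ _ _ _ (fun y => (\1_A y)%:E))//.
- rewrite (eq_integral (fun y => (\1_A y)%:E)) => [|y _].
    by rewrite integral_indic// setIT.
  by congr (\1_A _)%:E; apply: eq_from_tnth => t; rewrite tnth_mktuple.
- by move=> t; exact: measurable_id.
- by move=> t; exact: measurable_block_density.
- by move=> t x; exact: block_density_ge0.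
- move=> t h mh h0; rewrite /block_law /block_density.
  case: ifP => _; first exact: integral_spiked_gaussian.
  by apply: eq_integral => x _; rewrite mule1.
- by apply/measurable_EFinP; exact: measurable_indic.
Qed.

Let prod_block (q : R) a b : (a <= b)%N -> (b <= n)%N ->
  \prod_(t < n) (if (a <= t < b)%N then q else 1) = q ^+ (b - a).
Proof.
move=> ab bn; rewrite -big_mkcond /=.
rewrite -(big_mkord (fun t => (a <= t < b)%N) (fun=> q)).
rewrite -prodr_const_nat [RHS](big_nat_widen _ _ n)// [RHS](big_nat_widenl _ 0)//.
by apply: eq_bigl => t; rewrite andbC.
Qed.

Lemma block_overlap_same v w a b (zeta : R) : 0 < zeta ->
  \sum_(i < p) v i ^+ 2 = zeta -> \sum_(i < p) w i ^+ 2 = zeta ->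
  (\sum_(i < p) v i * w i) ^+ 2 < 1 -> (a <= b)%N -> (b <= n)%N ->
  (\int[tuple_prod (fun=> std_gaussian R p)]_y
     (block_likelihood v a b y * block_likelihood w a b y)%:E =
   ((Num.sqrt (1 - (\sum_(i < p) v i * w i) ^+ 2))^-1 ^+ (b - a))%:E)%E.
Proof.
move=> z0 vz wz vw ab bn.
rewrite -(prod_block _ ab bn) -prodEFin.
rewrite (eq_integral (fun y => (\prod_(t < n)
  (block_density v a b t (tnth y t) * block_density w a b t (tnth y t)))%:E)).
  rewrite (@integral_tuple_prod_prod _ _ _ n (fun=> std_gaussian R p)
    (fun t x => block_density v a b t x * block_density w a b t x)).
  - apply: eq_bigr => t _; rewrite /block_density; case: ifP => _.
      exact: (spike_overlap z0 vz wz vw).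
    rewrite (eq_integral (cst 1%E)) => [|x _]; last by rewrite mulr1.
    by rewrite integral_cst// mul1e; exact: probability_setT.
  - by move=> t; apply: measurable_funM; exact: measurable_block_density.
  - by move=> t x; rewrite mulr_ge0// block_density_ge0.
by move=> y _; rewrite big_split.
Qed.

(** At each time at most one of the two densities differs from 1, and it
    integrates to 1. *)
Lemma block_overlap_disjoint v w a b a' b' : (b <= a')%N || (b' <= a)%N ->
  (\int[tuple_prod (fun=> std_gaussian R p)]_y
     (block_likelihood v a b y * block_likelihood w a' b' y)%:E = 1)%E.
Proof.
move=> dis.
rewrite (eq_integral (fun y => (\prod_(t < n)
  (block_density v a b t (tnth y t) * block_density w a' b' t (tnth y t)))%:E)).
  rewrite (@integral_tuple_prod_prod _ _ _ n (fun=> std_gaussian R p)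
    (fun t x => block_density v a b t x * block_density w a' b' t x)).
  - rewrite big1// => t _; rewrite /block_density.
    case: (boolP (a <= t < b)%N) => h1; case: (boolP (a' <= t < b')%N) => h2.
    + by exfalso; lia.
    + by under eq_integral do rewrite mulr1; exact: integral_spike_density.
    + by under eq_integral do rewrite mul1r; exact: integral_spike_density.
    + rewrite (eq_integral (cst 1%E)) => [|x _]; last by rewrite mulr1.
      by rewrite integral_cst// mul1e; exact: probability_setT.
  - by move=> t; apply: measurable_funM; exact: measurable_block_density.
  - by move=> t x; rewrite mulr_ge0// block_density_ge0.
by move=> y _; rewrite big_split.
Qed.

End BlockLaw.

Section SignSpike.
Context (R : realType) (p : nat) (zeta : R).
Hypotheses (p0 : (0 < p)%N) (z0 : 0 < zeta).
Implicit Types e f : {ffun 'I_p -> bool}.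

(** The scaling gives squared norm [zeta], so that [spike_cov] of this vector is
    [I + zeta u u^T] for a unit vector [u]. *)
Definition sign_spike e (i : 'I_p) : R := Num.sqrt (zeta / p%:R) * (-1) ^+ e i.

Lemma sign_spike_dot e f :
  \sum_(i < p) sign_spike e i * sign_spike f i = zeta / p%:R * sgn_corr R e f.
Proof.
have zp : 0 <= zeta / p%:R by rewrite divr_ge0// ltW.
rewrite mulr_sumr; apply: eq_bigr => i _.
by rewrite /sign_spike mulrACA -expr2 sqr_sqrtr.
Qed.

Lemma sign_spike_norm e : \sum_(i < p) sign_spike e i ^+ 2 = zeta.
Proof.
under eq_bigr do rewrite expr2.
rewrite sign_spike_dot /sgn_corr (eq_bigr (fun=> 1)) => [|i _].
  by rewrite sumr_const card_ord mulfVK// pnatr_eq0 -lt0n.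
by rewrite -expr2 sqrr_sign.
Qed.

End SignSpike.

(** The estimator has countably many values, so an event about it is a countable
    union of the measurable level sets. *)
Lemma measurable_estimator_event (R : realType) (n p : nat)
    (tauhat : n.-tuple (p.-tuple R) -> seq nat) (Q : seq nat -> Prop) :
  estimator tauhat -> measurable [set y | Q (tauhat y)].
Proof.
move=> [_ mtau].
pose F i : set (n.-tuple (p.-tuple R)) :=
  if @unpickle (seq nat) i is Some s then
    if `[< Q s >] then tauhat @^-1` [set s] else set0
  else set0.
have mF i : measurable (F i).
  rewrite /F; case: (@unpickle (seq nat) i) => [s|]; last exact: measurable0.
  by case: ifP => _; [exact: mtau|exact: measurable0].
rewrite (_ : mkset _ = \bigcup_i F i); first exact: bigcupT_measurable.
apply/seteqP; split => y /=.
  move=> Qy; exists (pickle (tauhat y)) => //.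
  by rewrite /F pickleK; case: asboolP.
move=> [i _]; rewrite /F; case: (@unpickle (seq nat) i) => // s.
by case: asboolP => // Qs /= ->.
Qed.

(** Block number [j] occupies the 0-based times from [j.+1 * r] to
    [j.+2 * r - 1].  With [n %/ r - 2] blocks, at least [r] times are left before
    the first block and after the last. *)
Definition planted_likelihood (R : realType) (n p r : nat) (zeta : R)
    (k : 'I_(n %/ r - 2) * {ffun 'I_p -> bool}) :
    n.-tuple (p.-tuple R) -> R :=
  block_likelihood (sign_spike zeta k.2) (k.1.+1 * r) (k.1.+2 * r).

(** Among the [m] blocks, [m - 1] differ from that of [k'] and contribute
    [2^p] each, and the block of [k'] contributes at most [2^p (m + 1)]; the
    total is [2 m 2^p]. *)
Lemma chi2_bound (R : realType) (n p r : nat) (zeta : R)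
    (k' : 'I_(n %/ r - 2) * {ffun 'I_p -> bool}) :
  (1 <= p)%N -> (1 <= r)%N -> r%:R <= n%:R / 4 :> R -> 0 < zeta ->
  zeta ^+ 2 <= 1 / 2 ->
  r%:R * zeta ^+ 2 <= 1 / 16 * (p%:R + ln (n%:R / r%:R)) ->
  (\sum_(k : 'I_(n %/ r - 2) * {ffun 'I_p -> bool})
     \int[tuple_prod (fun=> std_gaussian R p)]_y
       (planted_likelihood zeta k y * planted_likelihood zeta k' y)%:E <=
   (2 * #|{: 'I_(n %/ r - 2) * {ffun 'I_p -> bool}}|%:R)%:E)%E.
Proof.
rewrite /planted_likelihood; case: k' => j f p1 r1 rn z0 z2 rz.
set m := (n %/ r - 2)%N in j f *.
have p0 : 0 < p%:R :> R by rewrite ltr0n.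
have dot1 e : (zeta / p%:R * sgn_corr R e f) ^+ 2 < 1.
  have := sgn_corr_le R e f; set s := sgn_corr R e f => s1.
  have -> : (zeta / p%:R * s) ^+ 2 = zeta ^+ 2 * (s ^+ 2 / p%:R ^+ 2).
    by field; rewrite gt_eqF.
  have : s ^+ 2 / p%:R ^+ 2 <= 1 by rewrite ler_pdivrMr ?exprn_gt0// mul1r.
  have : 0 <= s ^+ 2 / p%:R ^+ 2 by rewrite divr_ge0 ?sqr_ge0.
  by have := sqr_ge0 zeta; nra.
pose q e : R := (Num.sqrt (1 - (zeta / p%:R * sgn_corr R e f) ^+ 2))^-1 ^+ r.
have nr (i : 'I_m) : (i.+2 * r <= n)%N.
  by have := leq_trunc_div n r; have := ltn_ord i; rewrite /m; nia.
rewrite (eq_bigr (fun k => (if k.1 == j then q k.2 else 1)%:E))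
  => [|[i e] _] /=; last first.
  have [->|ij] := eqVneq i j.
    rewrite (block_overlap_same z0 (sign_spike_norm p1 z0 e)
      (sign_spike_norm p1 z0 f)) ?(sign_spike_dot z0)//.
    - by congr (_ ^+ _)%:E; nia.
    - by nia.
  rewrite block_overlap_disjoint// !leq_pmul2r//.
  by have : (i : nat) <> j by [move=> /val_inj/eqP; rewrite (negPf ij)]; lia.
rewrite sumEFin lee_fin.
rewrite -(pair_bigA _ (fun i e => if i == j then q e else 1)) /=.
rewrite (bigD1 j)//= eqxx.
rewrite [X in _ + X](eq_bigr (fun=> 2 ^+ p)) => [|i ij]; last first.
  rewrite (negPf ij).
  by rewrite sumr_const card_ffun card_bool card_ord natrX.
have qb : \sum_e q e <= 2 ^+ p * m.+1%:R by exact: overlap_bound.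
rewrite sumr_const card_prod card_ffun card_bool !card_ord natrM natrX.
have -> : #|[pred i | i != j]| = m.-1.
  by have := cardC1 j; rewrite card_ord => <-; apply: eq_card => i; rewrite !inE.
rewrite -[_ *+ m.-1]mulr_natr.
have m0 : (0 < m)%N by exact: leq_ltn_trans (ltn_ord j).
have -> : m.-1%:R = m%:R - 1 :> R by rewrite -{2}(prednK m0) -natr1 addrK.
apply: (le_trans (lerD qb (lexx _))).
by rewrite -natr1 le_eqVlt; apply/orP; left; apply/eqP; ring.
Qed.

Theorem proposition6 (R : realType) :
  exists c : R, 0 < c /\
    forall (n p r : nat) (zeta : R),
      (2 <= n)%N -> (1 <= p)%N -> (1 <= r)%N -> r%:R <= n%:R / 4 :> R ->
      0 < zeta -> zeta < 1 / Num.sqrt 2 ->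
      r%:R * zeta ^+ 2 <=
        Num.min (c * (p%:R + ln (n%:R / r%:R))) (r%:R / 2) ->
      ((1 / 4)%:E <=
        ereal_inf [set max_error r zeta tauhat | tauhat in @estimator R n p])%E.
Proof.
exists (1 / 16); split=> [|n p r zeta _ p1 r1 rn z0 _]; first by lra.
rewrite le_min => /andP[rz rz2].
have r0 : 0 < r%:R :> R by rewrite ltr0n.
have z2 : zeta ^+ 2 <= 1 / 2.
  by rewrite -(ler_pM2l r0); lra.
have n4 : (4 * r <= n)%N by rewrite -(ler_nat R) natrM; lra.
have q4 : (4 <= n %/ r)%N by rewrite leq_divRL.
apply: le_ereal_inf_tmp => _ [tauhat etau <-].
pose A := [set y | size (tauhat y) <> 0%N].
have mA : measurable A by exact: (measurable_estimator_event (fun s => size s <> 0%N)).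
pose K := ('I_(n %/ r - 2) * {ffun 'I_p -> bool})%type.
pose a (k : K) := (k.1.+1 * r)%N; pose b (k : K) := (k.1.+2 * r)%N.
pose P (k : K) := tuple_prod (@block_law R n p (sign_spike zeta k.2) (a k) (b k)).
have [|||||PA|[k PkA]] := @le_cam _ _ R K
    (tuple_prod (fun _ : 'I_n => std_gaussian R p)) P
    (@planted_likelihood R n p r zeta) _ _ _ _ _ A mA.
- by move=> k; exact: measurable_block_likelihood.
- by move=> k y; exact: block_likelihood_ge0.
- by move=> k B mB; exact: block_law_likelihood.
- rewrite card_prod card_ffun card_bool !card_ord muln_gt0 expn_gt0 andbT.
  by lia.
- by move=> k'; exact: chi2_bound.
- apply: (le_trans PA); apply: ereal_sup_ubound.
  exists (block_seq n 1%:M 0 0), (tuple_prod (fun _ : 'I_n => std_gaussian R p)).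
  have [nb Pb] := Pbar_constant n p r zeta.
  by split=> //; [exact: is_law_constant|rewrite nb].
apply: (le_trans PkA).
have ka := ltn_ord k.1; have nn := leq_trunc_div n r.
have [|||nb Pb] := @Pbar_block_seq R n p r (a k) (b k) zeta
    (sign_spike zeta k.2) z0 (sign_spike_norm p1 z0 k.2) r1.
- by rewrite /a; nia.
- by rewrite /a /b; nia.
- rewrite /b addnC -mulSn; apply: (leq_trans _ nn); rewrite leq_pmul2r//.
  by move: ka; rewrite ltn_subRL.
apply: (@le_trans _ _ (P k [set y | size (tauhat y) <> 2%N])).
  apply: le_measure; rewrite ?inE.
  - exact: measurableC.
  - exact: (measurable_estimator_event (fun s => size s <> 2%N)).
  - by move=> y /= /contrapT ->.
apply: ereal_sup_ubound.
exists (block_seq n (spike_cov (sign_spike zeta k.2)) (a k) (b k)), (P k).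
by split=> //; [exact: is_law_block|rewrite nb].
Qed.
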